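(* Let $k$ be a field, $d \geqslant 1$ an integer, and $\mathcal{S}$ a $k$-linear $\operatorname{Hom}$-finite $(d+2)$-angulated category with split idempotents and $d$-suspension functor $\Sigma^d$, which is standard. Let $t \in \mathcal{S}$ be an Oppermann--Thomas cluster tilting object, $\mathcal{T} = \operatorname{add}(t)$, $\Gamma = \operatorname{End}_{\mathcal{S}}(t)$, and $F = \mathcal{S}(t,-) : \mathcal{S} \to \operatorname{mod}(\Gamma)$. Then there is a unique homomorphism $\theta : \operatorname{K}_0(\operatorname{mod}\Gamma) \to \operatorname{K}_0^{\operatorname{sp}}(\mathcal{T})$ of abelian groups such that for every $(d+2)$-angle $s_{d+1} \to \cdots \to s_0 \xrightarrow{\gamma} \Sigma^d s_{d+1}$ in $\mathcal{S}$, $$\sum_{i=0}^{d+1} (-1)^i \operatorname{index}^{\mathrm{pentagon}}_{\mathcal{T}}(s_i) = \theta\big([\operatorname{Im} F\gamma]\big).$$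
   Context: Notation: $\mathcal{S}(-,-) = \operatorname{Hom}_{\mathcal{S}}(-,-)$; $\operatorname{mod}(\Gamma)$ is the category of finitely generated right $\Gamma$-modules; $\operatorname{K}_0(\operatorname{mod}\Gamma)$ is its Grothendieck group; $\operatorname{K}_0^{\operatorname{sp}}(\mathcal{T})$ is the split Grothendieck group of the additive category $\mathcal{T}$. $d$-cluster tilting: for a triangulated category $\mathcal{C}$ with suspension $\Sigma$, a full subcategory $\mathcal{S} \subseteq \mathcal{C}$ is $d$-cluster tilting if it is functorially finite and $\mathcal{S} = \{c \mid \mathcal{C}(s,\Sigma^i c)=0 \text{ for all } s\in\mathcal{S}, 1 \leqslant i \leqslant d-1\} = \{c \mid \mathcal{C}(c,\Sigma^i s)=0 \text{ for all } s\in\mathcal{S}, 1 \leqslant i \leqslant d-1\}$. Standard: $\mathcal{S}$ is a $d$-cluster tilting subcategory, satisfying $\Sigma^d\mathcal{S} = \mathcal{S}$, of a $k$-linear $\operatorname{Hom}$-finite triangulated category $\mathcal{C}$ with split idempotents and suspension $\Sigma$, and the $(d+2)$-angulated structure of $\mathcal{S}$ is the one obtained from this by the theorem of Geiss--Keller--Oppermann: the $d$-suspension is the restriction to $\mathcal{S}$ of the $d$-th power of $\Sigma$, and the $(d+2)$-angles are the sequences $s_{d+1} \to s_d \to \cdots \to s_1 \to s_0 \xrightarrow{\gamma} \Sigma^d s_{d+1}$ in $\mathcal{S}$ for which there are objects $v_{1.5},\ldots,v_{d-0.5}$ of $\mathcal{C}$ and, writing $v_{d+0.5} = s_{d+1}$,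 $v_{0.5} = s_0$, triangles $v_{i+0.5} \to s_i \to v_{i-0.5} \xrightarrow{\gamma_{i-0.5}} \Sigma v_{i+0.5}$ in $\mathcal{C}$ for $1 \leqslant i \leqslant d$, such that each given morphism $s_{i+1} \to s_{i}$ with $1 \leqslant i \leqslant d-1$ is the composition $s_{i+1} \to v_{i+0.5} \to s_i$, the given morphisms $s_{d+1}\to s_d$ and $s_1\to s_0$ are the ones in the triangles, and $\gamma = \Sigma^{d-1}(\gamma_{d-0.5}) \circ \cdots \circ \Sigma(\gamma_{1.5}) \circ \gamma_{0.5}$. Oppermann--Thomas cluster tilting object: $t \in \mathcal{S}$ with (i) $\mathcal{S}(t,\Sigma^d t)=0$, and (ii) for each $s \in \mathcal{S}$ there is a $(d+2)$-angle $t_d \to \cdots \to t_0 \to s \to \Sigma^d t_d$ in $\mathcal{S}$ with all $t_i \in \operatorname{add}(t)$. $(d+2)$-angulated index: for $s \in \mathcal{S}$, choose a $(d+2)$-angle $t_d \xrightarrow{\tau_d} \cdots \xrightarrow{\tau_1} t_0 \to s \to \Sigma^d t_d$ in $\mathcal{S}$ with $t_i \in \mathcal{T}$ and each $\tau_i$ in the radical of $\mathcal{S}$ (such a $(d+2)$-angle exists and is unique up to isomorphism). Then $\operatorname{index}^{\mathrm{pentagon}}_{\mathcal{T}}(s) = \sum_{i=0}^d (-1)^i [t_i] \in \operatorname{K}_0^{\operatorname{sp}}(\mathcal{T})$. *)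

(* Defs.v *)
From HB Require Import structures.
From mathcomp Require Import all_boot all_algebra ring_quotient.
From mathcomp.classical Require Import mathcomp_extra boolp.
From mathcomp.multinomials Require Import freeg.

Set Implicit Arguments.
Unset Strict Implicit.
Unset Printing Implicit Defensive.

Import GRing.Theory.
Local Open Scope ring_scope.

(* The carriers [mor a b] below, and [fg_sort] further down, are given as a
   type together with an lmodType class instead of as an lmodType: they then
   live in a universe below the one of lmodType and zmodType, so that
   Grothendieck groups, whose generators range over all objects of a category,
   can still be zmodTypes. *)
Record klinear_quiver (k : fieldType) := KLinearQuiver {
  obj :> Type;
  mor : obj -> obj -> Type;
  mor_class : forall a b, GRing.Lmodule k (mor a b) }.

HB.instance Definition _ (k : fieldType) (Q : klinear_quiver k) (a b : Q) :
  GRing.Lmodule k (mor a b) := mor_class a b.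

Record klinear_category (k : fieldType) := KLinearCategory {
  quiver :> klinear_quiver k;
  idm : forall a : quiver, mor a a;
  compm : forall a b c : quiver, mor b c -> mor a b -> mor a c;
  comp1m : forall (a b : quiver) (f : mor a b), compm (idm b) f = f;
  compm1 : forall (a b : quiver) (f : mor a b), compm f (idm a) = f;
  compmA : forall (a b c e : quiver) (h : mor c e) (g : mor b c) (f : mor a b),
    compm h (compm g f) = compm (compm h g) f;
  compm_linear_l : forall (a b c : quiver) (f : mor a b),
    linear (fun g : mor b c => compm g f);
  compm_linear_r : forall (a b c : quiver) (g : mor b c),
    linear (fun f : mor a b => compm g f) }.

Arguments idm {k C} a : rename.
Notation "g ∘ f" := (compm g f) (at level 40, left associativity).

Section Categories.
Variables (k : fieldType) (C : klinear_category k).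
Implicit Types a b c z : C.

Definition is_iso a b (f : mor a b) :=
  exists g : mor b a, g ∘ f = idm a /\ f ∘ g = idm b.

Definition isomorphic a b := exists f : mor a b, is_iso f.

Definition zero_object z :=
  forall a, (forall f : mor z a, f = 0) /\ (forall f : mor a z, f = 0).

Definition direct_sum a b c :=
  exists (i1 : mor a c) (i2 : mor b c) (p1 : mor c a) (p2 : mor c b),
    [/\ p1 ∘ i1 = idm a, p2 ∘ i2 = idm b, p1 ∘ i2 = 0, p2 ∘ i1 = 0
      & i1 ∘ p1 + i2 ∘ p2 = idm c].

Definition direct_sum_fam n (x : 'I_n -> C) c :=
  exists (inj : forall j, mor (x j) c) (prj : forall j, mor c (x j)),
    [/\ forall j, prj j ∘ inj j = idm (x j),
        forall i j, i != j -> prj j ∘ inj i = 0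
      & \sum_j inj j ∘ prj j = idm c].

Definition additive_category :=
  (exists z, zero_object z) /\ (forall a b, exists c, direct_sum a b c).

Definition split_idempotents :=
  forall a (e : mor a a), e ∘ e = e ->
    exists b (p : mor a b) (i : mor b a), i ∘ p = e /\ p ∘ i = idm b.

Definition hom_finite :=
  forall a b, exists n, inhabited (Vector.axiom n (mor a b)).

Definition add_closure t : C -> Prop := fun x =>
  exists n w y, direct_sum_fam (fun _ : 'I_n => t) w /\ direct_sum x y w.

(* The Jacobson radical of the category. For a full subcategory it is the
   same condition, as only endomorphisms of [a] and maps [b -> a] occur. *)
Definition radical a b (f : mor a b) :=
  forall g : mor b a, is_iso (idm a - g ∘ f).

Definition functorially_finite (S : C -> Prop) :=
  forall c,
    (exists s (f : mor s c), S s /\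
       forall s' (g : mor s' c), S s' -> exists h : mor s' s, g = f ∘ h) /\
    (exists s (f : mor c s), S s /\
       forall s' (g : mor c s'), S s' -> exists h : mor s s', g = h ∘ f).

Record klinear_endofunctor := KLinearEndofunctor {
  fobj :> C -> C;
  fmap : forall a b, mor a b -> mor (fobj a) (fobj b);
  fmap1 : forall a, fmap (idm a) = idm (fobj a);
  fmapM : forall a b c (g : mor b c) (f : mor a b),
    fmap (g ∘ f) = fmap g ∘ fmap f;
  fmap_linear : forall a b, linear (@fmap a b) }.

Definition is_equivalence (F : klinear_endofunctor) :=
  (forall a b, bijective (@fmap F a b)) /\
  (forall b, exists a, isomorphic (F a) b).

End Categories.

Record triangulated_category (k : fieldType) := TriangulatedCategory {
  tri_cat :> klinear_category k;
  tri_additive : additive_category tri_cat;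
  susp : klinear_endofunctor tri_cat;
  susp_equivalence : is_equivalence susp;
  triangle : forall a b c : tri_cat,
    mor a b -> mor b c -> mor c (susp a) -> Prop;
  triangle_iso : forall (a b c a' b' c' : tri_cat)
      (f : mor a b) (g : mor b c) (h : mor c (susp a))
      (f' : mor a' b') (g' : mor b' c') (h' : mor c' (susp a'))
      (u : mor a a') (v : mor b b') (w : mor c c'),
    is_iso u -> is_iso v -> is_iso w ->
    v ∘ f = f' ∘ u -> w ∘ g = g' ∘ v -> fmap susp u ∘ h = h' ∘ w ->
    triangle f g h -> triangle f' g' h';
  triangle_idm : forall a z : tri_cat, zero_object z ->
    triangle (idm a) (0 : mor a z) (0 : mor z (susp a));
  triangle_cone : forall (a b : tri_cat) (f : mor a b),
    exists (c : tri_cat) (g : mor b c) (h : mor c (susp a)), triangle f g h;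
  triangle_rot : forall (a b c : tri_cat)
      (f : mor a b) (g : mor b c) (h : mor c (susp a)),
    triangle f g h <-> triangle g h (- fmap susp f);
  triangle_mor : forall (a b c a' b' c' : tri_cat)
      (f : mor a b) (g : mor b c) (h : mor c (susp a))
      (f' : mor a' b') (g' : mor b' c') (h' : mor c' (susp a'))
      (u : mor a a') (v : mor b b'),
    triangle f g h -> triangle f' g' h' -> v ∘ f = f' ∘ u ->
    exists w : mor c c', w ∘ g = g' ∘ v /\ fmap susp u ∘ h = h' ∘ w;
  triangle_oct : forall (a b c p q r : tri_cat) (f : mor a b) (g : mor b c)
      (f' : mor b p) (f'' : mor p (susp a))
      (g' : mor c q) (g'' : mor q (susp b))
      (h' : mor c r) (h'' : mor r (susp a)),
    triangle f f' f'' -> triangle g g' g'' -> triangle (g ∘ f) h' h'' ->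
    exists (u : mor p r) (v : mor r q),
      [/\ triangle u v (fmap susp f' ∘ g''),
          u ∘ f' = h' ∘ g, h'' ∘ u = f'', v ∘ h' = g'
        & g'' ∘ v = fmap susp f ∘ h''] }.

Section ClusterTilting.
Variables (k : fieldType) (C : triangulated_category k).
Implicit Types (S : C -> Prop) (c s t y : C) (d n : nat).

Definition suspn n c : C := iter n (susp C) c.

Definition cluster_tilting d S :=
  [/\ functorially_finite S,
      forall c, S c <->
        (forall s i, S s -> (1 <= i <= d.-1)%N ->
           forall f : mor s (suspn i c), f = 0)
    & forall c, S c <->
        (forall s i, S s -> (1 <= i <= d.-1)%N ->
           forall f : mor c (suspn i s), f = 0)].

(* [susp] is only required to be an autoequivalence, so the image of [S] is
   taken up to isomorphism. *)
Definition suspn_stable d S :=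
  forall c, S c <-> exists s, S s /\ isomorphic (suspn d s) c.

(* The triangles v_{i+0.5} -> s_i -> v_{i-0.5} -> susp v_{i+0.5}, 1 <= i <= d,
   with connecting maps g_{i-0.5}, v_{0.5} = s_0 and v_{d+0.5} = s_{d+1}.
   Here x_j = s_{j+1}, y = s_0 and d = n + 1. The recursion peels off the
   triangle with i = 1, where v = v_{1.5} and g = g_{0.5}; [e] and [gam'] belong
   to the tower of the remaining triangles, which ends at v in place of s_0.
   Unfolding gam = susp gam' ∘ g gives the composite
   susp^(d-1) g_{d-0.5} ∘ ... ∘ susp g_{1.5} ∘ g_{0.5}. *)
Fixpoint triangle_tower n : forall (x : nat -> C) (y : C)
    (xi : forall j, mor (x j.+1) (x j)) (eps : mor (x 0%N) y)
    (gam : mor y (suspn n.+1 (x n.+1))), Prop :=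
  match n with
  | 0 => fun x y xi eps gam => triangle (xi 0%N) eps gam
  | n'.+1 => fun x y xi eps gam =>
      exists (v : C) (m : mor v (x 0%N)) (e : mor (x 1%N) v)
             (g : mor y (susp C v)) (gam' : mor v (suspn n'.+1 (x n'.+2))),
        [/\ triangle m eps g,
            xi 0%N = m ∘ e,
            triangle_tower (x := fun j => x j.+1) (fun j => xi j.+1) e gam'
          & gam = fmap (susp C) gam' ∘ g]
  end.

(* The (d+2)-angles x_d -> ... -> x_0 -> y -> susp^d x_d in S. Sequences are
   indexed by nat; the terms x_j with j > d and the maps xi_j with j >= d are
   unconstrained padding. *)
Definition angle d S : forall (x : nat -> C) (y : C)
    (xi : forall j, mor (x j.+1) (x j)) (eps : mor (x 0%N) y)
    (gam : mor y (suspn d (x d))), Prop :=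
  match d with
  | 0 => fun _ _ _ _ _ => False
  | n.+1 => fun x y xi eps gam =>
      [/\ S y, forall j, (j <= n.+1)%N -> S (x j)
        & triangle_tower xi eps gam]
  end.

Definition OT_cluster_tilting d S t :=
  [/\ S t,
      forall f : mor t (suspn d t), f = 0
    & forall s, S s ->
        exists (x : nat -> C) (xi : forall j, mor (x j.+1) (x j))
               (eps : mor (x 0%N) s) (gam : mor s (suspn d (x d))),
          (forall j, (j <= d)%N -> add_closure t (x j)) /\
          angle S xi eps gam].

End ClusterTilting.

Section Presentation.
Variables (X : choiceType) (R : {freeg X} -> Prop).

Definition relation_subgroup : {pred {freeg X}} := fun z =>
  `[< forall P : {freeg X} -> Prop,
        P 0 -> (forall u v, P u -> P v -> P (u - v)) ->
        (forall u, R u -> P u) -> P z >].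

Fact relation_subgroup_zmod : zmod_closed relation_subgroup.
Proof.
split=> [|u v /asboolP uP /asboolP vP]; apply/asboolP => P P0 PB PR //.
by apply: (PB); [apply: uP | apply: vP].
Qed.

HB.instance Definition _ :=
  GRing.isZmodClosed.Build {freeg X} relation_subgroup relation_subgroup_zmod.

Definition presented_group := Quotient.quot relation_subgroup.

HB.instance Definition _ := GRing.Zmodule.on presented_group.

Definition presented_gen (x : X) : presented_group :=
  (\pi_presented_group (<< x >> : {freeg X}))%qT.

End Presentation.

Section SplitK0.
Variables (k : fieldType) (C : klinear_category k) (T : C -> Prop).

Definition full_sub := {x : C | T x}.

HB.instance Definition _ := gen_eqMixin full_sub.
HB.instance Definition _ := gen_choiceMixin full_sub.

Definition K0sp_rel (z : {freeg full_sub}) :=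
  exists a b c : full_sub,
    direct_sum (sval a) (sval b) (sval c) /\ z = << c >> - << a >> - << b >>.

Definition K0sp := presented_group K0sp_rel.

HB.instance Definition _ := GRing.Zmodule.on K0sp.

Definition K0sp_class (x : full_sub) : K0sp := presented_gen K0sp_rel x.

End SplitK0.

Definition finitely_generated (R : pzRingType) (M : lmodType R) :=
  exists n (e : 'I_n -> M), forall x, exists c : 'I_n -> R,
    x = \sum_i c i *: e i.

(* Right modules over Gam are left modules over the converse ring Gam^c. *)
Record fgmod (Gam : pzRingType) := FgMod {
  fg_sort :> Type;
  fg_class : GRing.Lmodule Gam^c fg_sort;
  fg_finite : finitely_generated (GRing.Lmodule.Pack fg_class) }.

HB.instance Definition _ (Gam : pzRingType) (M : fgmod Gam) :
  GRing.Lmodule Gam^c (fg_sort M) := fg_class M.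

Section ModK0.
Variable Gam : pzRingType.

HB.instance Definition _ := gen_eqMixin (fgmod Gam).
HB.instance Definition _ := gen_choiceMixin (fgmod Gam).

Definition short_exact (M' M M'' : fgmod Gam)
    (f : {linear M' -> M}) (g : {linear M -> M''}) :=
  [/\ injective f, forall z, exists y, g y = z
    & forall y, g y = 0 <-> exists x, f x = y].

Definition K0mod_rel (z : {freeg (fgmod Gam)}) :=
  exists (M' M M'' : fgmod Gam) (f : {linear M' -> M}) (g : {linear M -> M''}),
    short_exact f g /\ z = << M >> - << M' >> - << M'' >>.

Definition K0mod := presented_group K0mod_rel.

HB.instance Definition _ := GRing.Zmodule.on K0mod.

Definition K0mod_class (M : fgmod Gam) : K0mod := presented_gen K0mod_rel M.

Section Image.
Variables (M N : fgmod Gam) (f : {linear M -> N}).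

Definition in_image : {pred N} := fun y => `[< exists x, f x = y >].

Fact in_image_submod : submod_closed in_image.
Proof.
split=> [|a u v /asboolP[x <-] /asboolP[y <-]]; apply/asboolP.
  by exists 0; rewrite linear0.
by exists (a *: x + y); rewrite linearP.
Qed.

HB.instance Definition _ :=
  GRing.isSubmodClosed.Build Gam^c N in_image in_image_submod.

Definition image_sort := {y : N | y \in in_image}.

HB.instance Definition _ := SubChoice.on image_sort.
HB.instance Definition _ := [SubChoice_isSubLmodule of image_sort by <:].

Fact image_finite : finitely_generated (image_sort : lmodType Gam^c).
Proof.
have [n [e eP]] := fg_finite M.
have fP i : f (e i) \in in_image by apply/asboolP; exists (e i).
exists n, (fun i => Sub (f (e i)) (fP i)) => -[y yP].
have /asboolP[x xy] := yP; have [c xE] := eP x; exists c.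
apply: val_inj; rewrite [LHS]/= -xy xE linear_sum [RHS]raddf_sum.
by apply: eq_bigr => i _; rewrite [LHS]linearZ.
Qed.

Definition image_mod : fgmod Gam :=
  @FgMod Gam image_sort (GRing.Lmodule.class image_sort) image_finite.

End Image.
End ModK0.

Section HomFunctor.
Variables (k : fieldType) (C : klinear_category k) (hf : hom_finite C) (t : C).

Definition endo : Type := mor t t.

HB.instance Definition _ := GRing.Zmodule.on endo.

Fact endo_mulDl :
  left_distributive (fun g f : endo => g ∘ f : endo) +%R.
Proof.
move=> f g h; have /(_ 1 f g) := @compm_linear_l k C t t t h.
by rewrite !scale1r.
Qed.

Fact endo_mulDr :
  right_distributive (fun g f : endo => g ∘ f : endo) +%R.
Proof.
move=> h f g; have /(_ 1 f g) := @compm_linear_r k C t t t h.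
by rewrite !scale1r.
Qed.

HB.instance Definition _ := GRing.Zmodule_isPzRing.Build endo
  (fun h g f => compmA h g f) (@comp1m k C t t) (@compm1 k C t t)
  endo_mulDl endo_mulDr.

(* A copy of [mor t s], carrying the right action of [endo] instead of the
   action of [k]. *)
Definition hom_from (s : C) : Type := mor t s.

HB.instance Definition _ s := GRing.Zmodule.on (hom_from s).

Definition hom_from_scale s (a : endo^c) (x : hom_from s) : hom_from s :=
  (x : mor t s) ∘ (a : mor t t).

Fact hom_from_scaleA s (a b : endo^c) (x : hom_from s) :
  hom_from_scale a (hom_from_scale b x) = hom_from_scale (a * b) x.
Proof. by rewrite /hom_from_scale -compmA. Qed.

Fact hom_from_scale1 s : left_id 1 (@hom_from_scale s).
Proof. by move=> x; rewrite /hom_from_scale compm1. Qed.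

Fact hom_from_scaleDr s : right_distributive (@hom_from_scale s) +%R.
Proof.
move=> a x y; have /(_ 1 x y) := @compm_linear_l k C t t s a.
by rewrite !scale1r.
Qed.

Fact hom_from_scaleDl s (x : hom_from s) :
  {morph (@hom_from_scale s)^~ x : a b / a + b}.
Proof.
move=> a b; have /(_ 1 a b) := @compm_linear_r k C t t s x.
by rewrite !scale1r.
Qed.

HB.instance Definition _ s := GRing.Zmodule_isLmodule.Build endo^c (hom_from s)
  (@hom_from_scaleA s) (@hom_from_scale1 s) (@hom_from_scaleDr s)
  (@hom_from_scaleDl s).

Fact hom_from_finite s : finitely_generated (hom_from s : lmodType endo^c).
Proof.
have [n [[v2r v2r_lin [r2v v2rK r2vK]]]] := hf t s.
pose e i : mor t s := r2v (delta_mx 0 i).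
exists n, e => x; exists (fun i => v2r x 0 i *: idm t).
have kE (c : k) (y : mor t s) : y ∘ (c *: idm t) = c *: y.
  have y0 : y ∘ (0 : mor t t) = 0.
    have := @compm_linear_r k C t t s y (-1) 0 0.
    by rewrite scaler0 addr0 scaleN1r addNr.
  have := @compm_linear_r k C t t s y c (idm t) 0.
  by rewrite !addr0 y0 addr0 compm1.
have r2v_lin : linear r2v.
  move=> a u v; apply: (can_inj v2rK).
  by rewrite r2vK v2r_lin !r2vK.
have r2v0 : r2v 0 = 0.
  by have := r2v_lin (-1) 0 0; rewrite scaler0 addr0 scaleN1r addNr.
have r2vD : {morph r2v : u v / u + v}.
  by move=> u v; have := r2v_lin 1 u v; rewrite !scale1r.
have r2vZ c u : r2v (c *: u) = c *: r2v u.
  by have := r2v_lin c u 0; rewrite r2v0 !addr0.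
rewrite -[LHS]v2rK [in LHS](row_sum_delta (v2r x)) (big_morph _ r2vD r2v0).
by apply: eq_bigr => i _; rewrite r2vZ -kE.
Qed.

Definition hom_mod (s : C) : fgmod endo :=
  @FgMod endo (hom_from s) (GRing.Lmodule.class (hom_from s)) (hom_from_finite s).

Section Map.
Variables (s s' : C) (f : mor s s').

Definition postcomp (x : hom_mod s) : hom_mod s' := f ∘ (x : mor t s).

Fact postcomp_linear : linear postcomp.
Proof.
move=> a x y; rewrite /postcomp.
have /(_ 1 (a *: x) y) := @compm_linear_r k C t s s' f.
rewrite !scale1r => ->; congr (_ + _); exact: compmA.
Qed.

HB.instance Definition _ := GRing.isLinear.Build endo^c (hom_mod s) (hom_mod s') *:%R postcomp postcomp_linear.
Definition hom_mod_map : {linear hom_mod s -> hom_mod s'} := postcomp.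
End Map.

End HomFunctor.

Section Index.
Variables (k : fieldType) (C : triangulated_category k).
Variables (S : C -> Prop) (d : nat) (t : C).

Local Notation T := (add_closure t).

Definition is_index (s : C) (z : K0sp T) :=
  exists (x : nat -> full_sub T)
         (xi : forall j, mor (sval (x j.+1)) (sval (x j)))
         (eps : mor (sval (x 0%N)) s) (gam : mor s (suspn d (sval (x d)))),
    [/\ @angle k C d S (fun j => sval (x j)) s xi eps gam,
        forall j, (j < d)%N -> radical (xi j)
      & z = \sum_(j < d.+1) K0sp_class (x j) *~ (-1) ^+ j].

(* The default value 0 is only taken if there is no such angle. *)
Definition angulated_index (s : C) : K0sp T :=
  if pselect (exists z, is_index s z) is left e then sval (cid e) else 0.

End Index.

(* Main.v *)
Require Import Defs.
From HB Require Import structures.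
From mathcomp Require Import all_boot all_algebra ring_quotient zify.
From mathcomp.classical Require Import boolp.
From mathcomp.multinomials Require Import freeg.

(* The object t is rigid in a strong sense: Hom(t, Σ^j t) = 0 for all
   1 <= j <= 2d-1, the range above d coming from Σ^d t ∈ S. Iterating T-precovers
   therefore resolves every object c of the triangulated category, not only the
   objects of S, by 2d terms of T; their alternating sum is an index ind(c), which
   extends the (d+2)-angulated index.

   Call h ghost if Hom(t, h) = 0. For a triangle a -> b -> c -h-> Σa with h ghost,
   ind(b) = ind(a) + ind(c). For an arbitrary triangle, the octahedral axiom shows
   that the defect ind(a) - ind(b) + ind(c) depends only on the Γ-module
   Im Hom(t, h) and is additive on short exact sequences, which yields θ on
   K_0(mod Γ).

   A (d+2)-angle is a tower of d triangles. The connecting maps of all of them but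
   the first one, γ_{0.5}, are ghost, and Im Fγ = Im Fγ_{0.5}, so the alternating
   sum of indices telescopes to θ[Im Fγ].

   For uniqueness, [M] = [F t_0] - [Im Fφ] for a presentation Fφ : F t_1 -> F t_0
   of M, and every morphism between objects of S is, up to isomorphism, the last
   map of a (d+2)-angle. *)

Set Implicit Arguments.
Unset Strict Implicit.
Unset Printing Implicit Defensive.

Import GRing.Theory.
Local Open Scope ring_scope.

(** * Groups given by generators and relations *)

Section PresentedGroup.
Variables (X : choiceType) (R : {freeg X} -> Prop).

Lemma presented_rel0 z : R z -> (\pi_(presented_group R) z)%qT = 0.
Proof.
move=> Rz; have -> : 0 = (\pi_(presented_group R) (0 : {freeg X}))%qT.
  by rewrite raddf0.
apply/eqP; rewrite -Quotient.idealrBE subr0.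
by apply/asboolP => P _ _; apply.
Qed.

Lemma presented_relB x y z : R (<< x >> - << y >> - << z >>) ->
  presented_gen R x = presented_gen R y + presented_gen R z.
Proof.
move=> /presented_rel0; rewrite !raddfB -addrA -opprD => /eqP.
by rewrite subr_eq0 => /eqP.
Qed.

Lemma presented_ext (G : zmodType) (f g : {additive presented_group R -> G}) :
  (forall x, f (presented_gen R x) = g (presented_gen R x)) -> f =1 g.
Proof.
move=> fg; elim/quotW=> z; elim/freeg_ind_dom0: z => [|n x z _ _ IH].
  by rewrite raddf0 !raddf0.
rewrite raddfD !raddfD IH; congr (_ + _).
rewrite -[n]intz -[n%:~R]/(1 *~ n) -freeg_mulz raddfMz !raddfMz.
by congr (_ *~ _); apply: fg.
Qed.

Section Lift.
Variables (G : zmodType) (f : X -> G).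

(** [zmodule G] regards the abelian group as a module over the integers, which is the structure that
    [fglift] expects of its target. *)
Definition freeg_lift (z : {freeg X}) : G := fglift (f : X -> zmodule G) z.

Fact freeg_lift_zmod_morphism : zmod_morphism freeg_lift.
Proof. exact: (lift_is_additive (f : X -> zmodule G)). Qed.

HB.instance Definition _ :=
  GRing.isZmodMorphism.Build {freeg X} G freeg_lift freeg_lift_zmod_morphism.

Lemma freeg_liftU x : freeg_lift << x >> = f x.
Proof. by rewrite /freeg_lift liftU scale1r. Qed.

Hypothesis fR : forall z, R z -> freeg_lift z = 0.

(** Computed on the chosen representative; the choice is immaterial once [freeg_lift] kills the
    relations, hence the subgroup they generate. *)
Definition presented_lift (x : presented_group R) : G := freeg_lift (repr x).

Lemma presented_lift_pi z :
  presented_lift (\pi_(presented_group R) z)%qT = freeg_lift z.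
Proof.
apply/eqP; rewrite -subr_eq0 -raddfB; apply/eqP.
have : (repr (\pi_(presented_group R) z)%qT - z) \in relation_subgroup R.
  by rewrite Quotient.idealrBE reprK.
move/asboolP/(_ (fun w => freeg_lift w = 0)); apply=> //; first exact: raddf0.
by move=> u v u0 v0; rewrite raddfB /= u0 v0 subr0.
Qed.

Fact presented_lift_zmod_morphism : zmod_morphism presented_lift.
Proof.
elim/quotW=> u; elim/quotW=> v.
by rewrite -raddfB !presented_lift_pi raddfB.
Qed.

HB.instance Definition _ := GRing.isZmodMorphism.Build (presented_group R) G
  presented_lift presented_lift_zmod_morphism.

Lemma presented_liftP : exists phi : {additive presented_group R -> G},
  forall x, phi (presented_gen R x) = f x.
Proof.
by exists presented_lift => x; rewrite [LHS]presented_lift_pi freeg_liftU.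
Qed.

End Lift.

Lemma presented_liftB (G : zmodType) (f : X -> G) :
  (forall z, R z -> exists x y w,
     z = << x >> - << y >> - << w >> /\ f x = f y + f w) ->
  exists phi : {additive presented_group R -> G},
    forall x, phi (presented_gen R x) = f x.
Proof.
move=> fR; apply: presented_liftP => z /fR[x [y [w [-> E]]]].
by rewrite !raddfB /= !freeg_liftU E -addrA -opprD subrr.
Qed.

End PresentedGroup.

(** * Linear categories *)

Section LinearCategory.
Variables (k : fieldType) (C : klinear_category k).
Implicit Types a b c x y z t : C.

Lemma compmDl a b c (g g' : mor b c) (f : mor a b) :
  (g + g') ∘ f = g ∘ f + g' ∘ f.
Proof. by have := compm_linear_l f 1 g g'; rewrite !scale1r. Qed.

Lemma compmDr a b c (g : mor b c) (f f' : mor a b) :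
  g ∘ (f + f') = g ∘ f + g ∘ f'.
Proof. by have := compm_linear_r g 1 f f'; rewrite !scale1r. Qed.

Lemma comp0m a b c (f : mor a b) : (0 : mor b c) ∘ f = 0.
Proof. by apply: (addrI (0 ∘ f)); rewrite -compmDl !addr0. Qed.

Lemma compm0 a b c (g : mor b c) : g ∘ (0 : mor a b) = 0.
Proof. by apply: (addrI (g ∘ 0)); rewrite -compmDr !addr0. Qed.

Lemma compmNl a b c (g : mor b c) (f : mor a b) : (- g) ∘ f = - (g ∘ f).
Proof. by apply: (addIr (g ∘ f)); rewrite -compmDl !addNr comp0m. Qed.

Lemma compmNr a b c (g : mor b c) (f : mor a b) : g ∘ (- f) = - (g ∘ f).
Proof. by apply: (addIr (g ∘ f)); rewrite -compmDr !addNr compm0. Qed.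

Lemma compmBl a b c (g g' : mor b c) (f : mor a b) :
  (g - g') ∘ f = g ∘ f - g' ∘ f.
Proof. by rewrite compmDl compmNl. Qed.

Lemma compmBr a b c (g : mor b c) (f f' : mor a b) :
  g ∘ (f - f') = g ∘ f - g ∘ f'.
Proof. by rewrite compmDr compmNr. Qed.

Lemma compmZl a b c (r : k) (g : mor b c) (f : mor a b) :
  (r *: g) ∘ f = r *: (g ∘ f).
Proof. by have := compm_linear_l f r g 0; rewrite !addr0 comp0m addr0. Qed.

Lemma compmZr a b c (r : k) (g : mor b c) (f : mor a b) :
  g ∘ (r *: f) = r *: (g ∘ f).
Proof. by have := compm_linear_r g r f 0; rewrite !addr0 compm0 addr0. Qed.

Lemma compm_suml a b c I (s : seq I) (P : pred I) (g : I -> mor b c)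
    (f : mor a b) :
  (\sum_(i <- s | P i) g i) ∘ f = \sum_(i <- s | P i) g i ∘ f.
Proof.
by rewrite (big_morph (fun h : mor b c => h ∘ f) (fun g1 g2 => compmDl g1 g2 f)
  (@comp0m a b c f)).
Qed.

Lemma compm_sumr a b c I (s : seq I) (P : pred I) (g : mor b c)
    (f : I -> mor a b) :
  g ∘ (\sum_(i <- s | P i) f i) = \sum_(i <- s | P i) g ∘ f i.
Proof.
by rewrite (big_morph (fun h : mor a b => g ∘ h) (compmDr g) (@compm0 a b c g)).
Qed.

Lemma is_iso_id a : is_iso (idm a).
Proof. by exists (idm a); rewrite comp1m. Qed.

Lemma is_iso_opp a b (f : mor a b) : is_iso f -> is_iso (- f).
Proof.
by case=> g [gf fg]; exists (- g); rewrite !compmNl !compmNr !opprK.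
Qed.

Lemma zero_objectP z : idm z = 0 -> zero_object z.
Proof.
by move=> z0 a; split=> f; [rewrite -[f]compm1 | rewrite -[f]comp1m];
  rewrite z0 (compm0, comp0m).
Qed.

Lemma zero_object_dom z a (f : mor z a) : zero_object z -> f = 0.
Proof. by move=> /(_ a)[]. Qed.

Lemma zero_object_cod z a (f : mor a z) : zero_object z -> f = 0.
Proof. by move=> /(_ a)[]. Qed.

Lemma direct_sum0 a z : zero_object z -> direct_sum a z a.
Proof.
move=> z0; exists (idm a), 0, (idm a), 0.
split; rewrite ?comp1m ?compm1 ?compm0 ?addr0 //.
by rewrite [RHS](zero_object_dom _ z0).
Qed.

Lemma direct_sumC a b c : direct_sum a b c -> direct_sum b a c.
Proof.
case=> i1 [i2 [p1 [p2 [p11 p22 p12 p21 E]]]].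
by exists i2, i1, p2, p1; rewrite addrC.
Qed.

Definition hom0 a b := forall f : mor a b, f = 0.

(** If $h$ inverts $1 - gf$, then $1 + fhg$ inverts $1 - fg$. *)
Lemma is_iso_id_sub_swap a b (f : mor a b) (g : mor b a) :
  is_iso (idm a - g ∘ f) -> is_iso (idm b - f ∘ g).
Proof.
case=> h [hl hr]; exists (idm b + f ∘ h ∘ g).
have E1 : h ∘ (g ∘ f) = h - idm a by rewrite -[X in _ - X]hl compmBr compm1 opprB addrC subrK.
have E2 : (g ∘ f) ∘ h = h - idm a by rewrite -[X in _ - X]hr compmBl comp1m opprB addrC subrK.
split.
  have -> : (idm b + f ∘ h ∘ g) ∘ (idm b - f ∘ g) =
      idm b - f ∘ g + (f ∘ h ∘ g - f ∘ (h ∘ (g ∘ f)) ∘ g).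
    by rewrite compmDl comp1m compmBr compm1 !compmA.
  by rewrite E1 compmBr compmBl compm1 opprB [X in _ + X]addrC !subrK.
have -> : (idm b - f ∘ g) ∘ (idm b + f ∘ h ∘ g) =
    idm b - f ∘ g + (f ∘ h ∘ g - f ∘ (g ∘ f ∘ h) ∘ g).
  by rewrite compmDr compm1 compmBl comp1m !compmA.
by rewrite E2 compmBr compmBl compm1 opprB [X in _ + X]addrC !subrK.
Qed.

(** [radical] tests endomorphisms of the source only; cyclic rotation moves the new factor [e] into
    the test map [e ∘ g] for [m]. *)
Lemma radical_comp a b c (m : mor b c) (e : mor a b) :
  radical m -> radical (m ∘ e).
Proof.
move=> rm g; rewrite compmA; apply: is_iso_id_sub_swap.
by rewrite compmA; apply: rm.
Qed.

(** * The additive closure of an object, described by factorisations of identities *)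

Section AddClosure.
Hypothesis C_additive : additive_category C.
Variable t : C.

(** Maps through some power of [t], written in components so that no power has to be chosen. *)
Definition factors_through a b (h : mor a b) := exists n
  (q : 'I_n -> mor t b) (p : 'I_n -> mor a t), h = \sum_j q j ∘ p j.

Lemma factors_through_comp a b c e (g : mor b c) (h : mor a b) (f : mor e a) :
  factors_through h -> factors_through (g ∘ h ∘ f).
Proof.
case=> n [q [p ->]]; exists n, (fun j => g ∘ q j), (fun j => p j ∘ f).
by rewrite compm_sumr compm_suml; apply: eq_bigr => j _; rewrite !compmA.
Qed.

Lemma factors_throughD a b (h h' : mor a b) :
  factors_through h -> factors_through h' -> factors_through (h + h').
Proof.
case=> n [q [p ->]] [n' [q' [p' ->]]]; exists (n + n')%N.
exists (fun j => match split j with inl i => q i | inr i => q' i end).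
exists (fun j => match split j with inl i => p i | inr i => p' i end).
rewrite big_split_ord; congr (_ + _); apply: eq_bigr => j _.
  by rewrite (unsplitK (inl j)).
by rewrite (unsplitK (inr j)).
Qed.

Lemma exists_power n : exists w, direct_sum_fam (fun _ : 'I_n => t) w.
Proof.
case: C_additive => [[z z0] ds]; elim: n => [|n [w [inj [prj [ii ij E]]]]].
  exists z, (fun _ => 0), (fun _ => 0); split; try by case.
  by rewrite big_ord0 [RHS](zero_object_dom _ z0).
have [w' [i1 [i2 [p1 [p2 [p11 p22 p12 p21 E']]]]]] := ds t w; exists w'.
exists (fun j => if unlift ord0 j is Some i then i2 ∘ inj i else i1).
exists (fun j => if unlift ord0 j is Some i then prj i ∘ p2 else p1).
split=> [j|i j|].
- case: unliftP => [i _|_]; last by [].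
  by rewrite compmA -(compmA (prj i)) p22 compm1.
- case: (unliftP ord0 j) => [j' ->|->]; case: (unliftP ord0 i) => [i' ->|->] ne.
  + rewrite compmA -(compmA (prj j')) p22 compm1 ij //.
  + by rewrite -compmA p21 compm0.
  + by rewrite compmA p12 comp0m.
  + by rewrite eqxx in ne.
rewrite big_ord_recl unlift_none -E'; congr (_ + _).
rewrite -[p2 in RHS]comp1m -E compm_suml compm_sumr.
by apply: eq_bigr => i _; rewrite liftK !compmA.
Qed.

Lemma add_closure_factors x : add_closure t x -> factors_through (idm x).
Proof.
case=> n [w [y [[inj [prj [_ _ E]]] [i1 [i2 [p1 [p2 [p11 _ _ _ _]]]]]]]].
exists n, (fun j => p1 ∘ inj j), (fun j => prj j ∘ i1); rewrite -p11.
rewrite -[p1 in LHS]compm1 -E compm_sumr compm_suml.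
by apply: eq_bigr => j _; rewrite !compmA.
Qed.

(** The components assemble to maps $x \to t^n \to x$ composing to the identity, and splitting the
    complementary idempotent $1 - sr$ supplies the other summand. *)
Lemma factors_add_closure x :
  split_idempotents C -> factors_through (idm x) -> add_closure t x.
Proof.
move=> spl [n [q [p E]]]; have [w [inj [prj [ii ij Ew]]]] := exists_power n.
pose s := \sum_j inj j ∘ p j; pose r := \sum_j q j ∘ prj j.
have rs : r ∘ s = idm x.
  rewrite compm_suml E; apply: eq_bigr => j _; rewrite compm_sumr.
  rewrite (bigD1 j) //= big1 ?addr0 => [|i ne].
    by rewrite -compmA (compmA (prj j)) ii comp1m.
  by rewrite -compmA (compmA (prj j)) ij // comp0m compm0.
have idem : (idm w - s ∘ r) ∘ (idm w - s ∘ r) = idm w - s ∘ r.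
  rewrite compmBl comp1m compmBr compm1 compmA -(compmA s) rs compm1 subrr.
  by rewrite subr0.
have [y [p' [i' [E1 E2]]]] := spl w _ idem.
exists n, w, y; split; first by exists inj, prj.
have iE : i' = (idm w - s ∘ r) ∘ i' by rewrite -E1 -compmA E2 compm1.
have pE : p' = p' ∘ (idm w - s ∘ r) by rewrite -E1 compmA E2 comp1m.
exists s, i', r, p'; split=> //.
- by rewrite iE compmA compmBr compm1 compmA rs comp1m subrr comp0m.
- by rewrite pE -compmA compmBl comp1m -compmA rs compm1 subrr compm0.
- by rewrite E1 addrC subrK.
Qed.

Lemma add_closure_power n w :
  direct_sum_fam (fun _ : 'I_n => t) w -> add_closure t w.
Proof.
move=> dw; have [z z0] := C_additive.1; exists n, w, z; split=> //.
exact: direct_sum0.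
Qed.

Hypothesis spl : split_idempotents C.

Lemma add_closure_retract a b (r : mor a b) (s : mor b a) :
  r ∘ s = idm b -> add_closure t a -> add_closure t b.
Proof.
move=> rs /add_closure_factors/(factors_through_comp r s).
by rewrite compm1 rs; apply: factors_add_closure.
Qed.

Lemma add_closure_summand a b c :
  direct_sum a b c -> add_closure t c -> add_closure t a.
Proof. by case=> i1 [i2 [p1 [p2 [p11 _ _ _ _]]]]; apply: add_closure_retract p11. Qed.

Lemma add_closure_sum a b c :
  direct_sum a b c -> add_closure t a -> add_closure t b -> add_closure t c.
Proof.
case=> i1 [i2 [p1 [p2 [_ _ _ _ E]]]].
move=> /add_closure_factors/(factors_through_comp i1 p1) fa.
move=> /add_closure_factors/(factors_through_comp i2 p2) fb.
apply: factors_add_closure => //; rewrite -E.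
by have := factors_throughD fa fb; rewrite !compm1.
Qed.

Lemma add_closure_zero z : zero_object z -> add_closure t z.
Proof.
move=> z0; apply: factors_add_closure => //; exists 0%N.
exists (fun _ => 0), (fun _ => 0).
by rewrite big_ord0 [LHS](zero_object_dom _ z0).
Qed.

Lemma add_closure_eq0 a b (f : mor a b) : add_closure t a ->
  (forall x : mor t a, f ∘ x = 0) -> f = 0.
Proof.
move=> /add_closure_factors[n [q [p E]]] f0.
by rewrite -[f]compm1 E compm_sumr big1 // => j _; rewrite compmA f0 comp0m.
Qed.

End AddClosure.
End LinearCategory.

(** * Triangulated categories *)

Section Triangulated.
Variables (k : fieldType) (C : triangulated_category k).
Implicit Types a b c x y z t : C.

Local Notation Σ := (susp C).
Local Notation "'Σm' f" := (fmap (susp C) f) (at level 10, f at level 9).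

Lemma suspD a b (f g : mor a b) : Σm (f + g) = Σm f + Σm g.
Proof. by have := @fmap_linear k C Σ a b 1 f g; rewrite !scale1r. Qed.

Lemma susp0 a b : Σm (0 : mor a b) = 0.
Proof. by apply: (addrI (Σm 0)); rewrite -suspD !addr0. Qed.

Lemma suspN a b (f : mor a b) : Σm (- f) = - Σm f.
Proof. by apply: (addIr (Σm f)); rewrite -suspD !addNr susp0. Qed.

Lemma susp_full a b (g : mor (Σ a) (Σ b)) : exists f, Σm f = g.
Proof.
have [h _ hK] := (susp_equivalence C).1 a b.
by exists (h g); apply: hK.
Qed.

Lemma susp_inj a b (f g : mor a b) : Σm f = Σm g -> f = g.
Proof. exact: (bij_inj ((susp_equivalence C).1 a b)). Qed.

Lemma susp_eq0 a b (f : mor a b) : Σm f = 0 -> f = 0.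
Proof. by rewrite -(susp0 a b) => /susp_inj. Qed.

Lemma susp_ess_surj b : exists a (f : mor (Σ a) b), is_iso f.
Proof. by have [a [f fi]] := (susp_equivalence C).2 b; exists a, f. Qed.

Lemma susp_is_iso a b (f : mor a b) : is_iso f -> is_iso (Σm f).
Proof.
by case=> g [gf fg]; exists (Σm g); rewrite -!fmapM gf fg !fmap1.
Qed.

Lemma susp_zero_object z : zero_object z -> zero_object (Σ z).
Proof.
move=> z0; apply: zero_objectP.
by rewrite -fmap1 (zero_object_dom (idm z) z0) susp0.
Qed.

Lemma triangle_rotl a b c (f : mor a b) (g : mor b c) (h : mor c (Σ a)) :
  triangle f g h -> triangle g h (- Σm f).
Proof. by move/triangle_rot. Qed.

Lemma triangle_suspN a b c (f : mor a b) (g : mor b c) (h : mor c (Σ a)) :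
  triangle f g h <-> triangle (- Σm f) (- Σm g) (- Σm h).
Proof.
split=> [/triangle_rotl/triangle_rotl/triangle_rotl // | T].
by apply/triangle_rot/triangle_rot/triangle_rot.
Qed.

Lemma triangle_sign12 a b c (f : mor a b) (g : mor b c) (h : mor c (Σ a)) :
  triangle f g h -> triangle (- f) (- g) h.
Proof.
apply: (triangle_iso (is_iso_id a) (is_iso_opp (is_iso_id b)) (is_iso_id c)).
- by rewrite compmNl comp1m compm1.
- by rewrite compmNr compmNl compm1 comp1m opprK.
- by rewrite fmap1 comp1m compm1.
Qed.

(** Three rotations negate all three maps; the automorphism $-1$ of the middle term then restores
    the first two. *)
Lemma triangle_susp a b c (f : mor a b) (g : mor b c) (h : mor c (Σ a)) :
  triangle f g h -> triangle (Σm f) (Σm g) (- Σm h).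
Proof. by move/triangle_suspN/triangle_sign12; rewrite !opprK. Qed.

Lemma triangle_desusp a b c (f : mor a b) (g : mor b c) (h : mor c (Σ a)) :
  triangle (Σm f) (Σm g) (- Σm h) -> triangle f g h.
Proof. by move/triangle_sign12 => T; apply/triangle_suspN. Qed.

Lemma triangle_comp12 a b c (f : mor a b) (g : mor b c) (h : mor c (Σ a)) :
  triangle f g h -> g ∘ f = 0.
Proof.
move=> T; have [z z0] := (tri_additive C).1.
have [w [wE _]] := triangle_mor (u := idm a) (v := f) (triangle_idm a z0) T
  erefl.
by rewrite -wE compm0.
Qed.

Lemma triangle_comp23 a b c (f : mor a b) (g : mor b c) (h : mor c (Σ a)) :
  triangle f g h -> h ∘ g = 0.
Proof. by move/triangle_rotl/triangle_comp12. Qed.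

(** The map [u] extends to a morphism from the rotated trivial triangle $x \to 0 \to \Sigma x$,
    whose last component is $\Sigma$ of the required lift. *)
Lemma triangle_exact2 x a b c (f : mor a b) (g : mor b c) (h : mor c (Σ a))
    (u : mor x b) :
  triangle f g h -> g ∘ u = 0 -> exists w, u = f ∘ w.
Proof.
move=> T gu; have [z z0] := (tri_additive C).1.
have [|w [_ wE]] := triangle_mor (u := u) (v := 0 : mor z c)
  (triangle_rotl (triangle_idm x z0)) (triangle_rotl T).
  by rewrite gu comp0m.
have [v vE] := susp_full w; exists v; apply: susp_inj; move: wE.
by rewrite fmap1 compmNr compm1 compmNl -vE -fmapM => /oppr_inj.
Qed.

Lemma triangle_exact3 x a b c (f : mor a b) (g : mor b c) (h : mor c (Σ a))
    (u : mor x c) :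
  triangle f g h -> h ∘ u = 0 -> exists w, u = g ∘ w.
Proof. by move/triangle_rotl => T /(triangle_exact2 T). Qed.

Lemma triangle_exact1 x a b c (f : mor a b) (g : mor b c) (h : mor c (Σ a))
    (u : mor x (Σ a)) :
  triangle f g h -> Σm f ∘ u = 0 -> exists w, u = h ∘ w.
Proof.
move/triangle_rotl => T fu; apply: (triangle_exact3 T).
by rewrite compmNl fu oppr0.
Qed.

Lemma triangle_coexact2 x a b c (f : mor a b) (g : mor b c) (h : mor c (Σ a))
    (u : mor b x) :
  triangle f g h -> u ∘ f = 0 -> exists w, u = w ∘ g.
Proof.
move=> T uf; have [z z0] := (tri_additive C).1.
have T' : triangle (0 : mor z x) (idm x) (0 : mor x (Σ z)).
  apply/triangle_rot; rewrite susp0 oppr0.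
  exact: triangle_idm (susp_zero_object z0).
have [|w [wE _]] := triangle_mor (u := 0 : mor a z) (v := u) T T'.
  by rewrite comp0m uf.
by exists w; rewrite wE comp1m.
Qed.

Lemma triangle_coexact3 x a b c (f : mor a b) (g : mor b c) (h : mor c (Σ a))
    (u : mor c x) :
  triangle f g h -> u ∘ g = 0 -> exists w, u = w ∘ h.
Proof. by move/triangle_rotl => T /(triangle_coexact2 T). Qed.

(** Since [susp] is only an equivalence, the cone of [g] is first replaced by an isomorphic
    suspension; rotating back twice then gives the fibre. *)
Lemma triangle_fibre a c (g : mor c (Σ a)) :
  exists b (f : mor a b) (f' : mor b c), triangle f f' g.
Proof.
have [b' [u [v T]]] := triangle_cone g.
have [b [e ei]] := susp_ess_surj b'; have [e' [e'e ee']] := ei.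
have ei' : is_iso e' by exists e.
have [f fE] := susp_full (e' ∘ u); have [f' f'E] := susp_full (v ∘ e).
exists b, (- f), (- f').
apply/triangle_rot/triangle_rot; rewrite !suspN !opprK.
apply: (triangle_iso (is_iso_id c) (is_iso_id (Σ a)) ei') T.
- by rewrite comp1m compm1.
- by rewrite fE compm1.
by rewrite fmap1 comp1m f'E -compmA ee' compm1.
Qed.

Lemma triangle_cocone b c (g : mor b c) :
  exists a (f : mor a b) (h : mor c (Σ a)), triangle f g h.
Proof.
have [a' [u [v T]]] := triangle_cone g.
have [a [e ei]] := susp_ess_surj a'; have [e' [e'e ee']] := ei.
have ei' : is_iso e' by exists e.
have [f fE] := susp_full (v ∘ e).
exists a, (- f), (e' ∘ u).
apply/triangle_rot; rewrite !suspN !opprK.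
apply: (triangle_iso (is_iso_id b) (is_iso_id c) ei') T.
- by rewrite comp1m compm1.
- by rewrite compm1.
by rewrite fmap1 comp1m fE -compmA ee' compm1.
Qed.

Lemma triangle_rotr a c d (g : mor d c) (h : mor c (Σ a)) (f : mor (Σ a) (Σ d)) :
  triangle g h f -> exists i : mor a d, triangle i g h.
Proof.
have [i <-] := susp_full f => T.
by exists (- i); apply/triangle_rot; rewrite suspN opprK.
Qed.

(** The vanishing third map gives a section [s] of [g] and makes [f] monic; the retraction is the
    factor of $1 - sg$ through [f]. *)
Lemma triangle_split a b c (f : mor a b) (g : mor b c) :
  triangle f g (0 : mor c (Σ a)) -> exists (r : mor b a) (s : mor c b),
    [/\ r ∘ f = idm a, g ∘ s = idm c, r ∘ s = 0, g ∘ f = 0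
      & f ∘ r + s ∘ g = idm b].
Proof.
move=> T; have gf := triangle_comp12 T.
have [s sE] := triangle_exact3 (u := idm c) T (comp0m _ _).
have [|r rE] := triangle_exact2 (u := idm b - s ∘ g) T.
  by rewrite compmBr compm1 compmA -sE comp1m subrr.
have fI x (u : mor x a) : f ∘ u = 0 -> u = 0.
  move=> fu; apply: susp_eq0.
  have [|w ->] := triangle_exact1 (u := Σm u) T; last exact: comp0m.
  by rewrite -fmapM fu susp0.
exists r, s; split=> //; last by rewrite -rE subrK.
  apply/eqP; rewrite -subr_eq0; apply/eqP/fI.
  by rewrite compmBr compm1 compmA -rE compmBl comp1m -compmA gf compm0 subr0 subrr.
by apply: fI; rewrite compmA -rE compmBl comp1m -compmA -sE compm1 subrr.
Qed.

Lemma triangle_split_sum a b c (f : mor a b) (g : mor b c) :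
  triangle f g (0 : mor c (Σ a)) -> direct_sum a c b.
Proof.
by case/triangle_split=> r [s [rf gs rs gf E]]; exists f, s, r, g.
Qed.

(** The triangle on the zero map $c \to \Sigma a$ splits, so its middle term is another biproduct of
    [a] and [c], identified with the given one through the structure maps. *)
Lemma direct_sum_triangle a b c : direct_sum a c b ->
  exists (f : mor a b) (g : mor b c), triangle f g (0 : mor c (Σ a)).
Proof.
case=> i1 [i2 [p1 [p2 [p11 p22 p12 p21 E]]]]; exists i1, p2.
have [b' [f [g T]]] := triangle_fibre (0 : mor c (Σ a)).
have [r [s [rf gs rs gf E']]] := triangle_split T.
have vi : is_iso (i1 ∘ r + i2 ∘ g).
  exists (f ∘ p1 + s ∘ p2); rewrite !compmDl !compmDr.
  rewrite !compmA -!(compmA f) -!(compmA s) -!(compmA i1) -!(compmA i2).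
  rewrite p11 p22 p12 p21 rf gs rs gf !(comp0m, compm0, compm1, comp1m).
  by rewrite !(addr0, add0r) E E'.
apply: (triangle_iso (is_iso_id a) vi (is_iso_id c)) T.
- by rewrite compm1 compmDl -!compmA rf gf compm0 addr0 compm1.
- by rewrite comp1m compmDr !compmA p21 p22 comp0m comp1m add0r.
by rewrite compm0 comp0m.
Qed.

Lemma triangle_id_shift z a : zero_object z ->
  triangle (0 : mor a z) (0 : mor z (Σ a)) (- idm (Σ a)).
Proof. by move=> z0; rewrite -fmap1; apply/triangle_rotl/triangle_idm. Qed.

Lemma triangle_zero_id z a : zero_object z ->
  triangle (0 : mor z a) (idm a) (0 : mor a (Σ z)).
Proof.
move=> z0; apply/triangle_rot; rewrite susp0 oppr0.
exact: triangle_idm (susp_zero_object z0).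
Qed.

(** The octahedral axiom for the composite $g\alpha$, phrased with fibres instead of cones: all
    three triangles are rotated and the resulting maps desuspended. *)
Lemma octahedron_cocone c1 c z a l n (m : mor a c1) (α : mor c1 c)
    (κ : mor c (Σ a)) (i : mor l c) (g : mor c z) (δ : mor z (Σ l))
    (j : mor n c1) (ε : mor z (Σ n)) :
  triangle m α κ -> triangle i g δ -> triangle j (g ∘ α) ε ->
  exists (u : mor a n) (v : mor n l),
    [/\ triangle u v (κ ∘ i), j ∘ u = m, i ∘ v = α ∘ j & Σm v ∘ ε = δ].
Proof.
move=> /triangle_rotl T1 /triangle_rotl T2 /triangle_rotl T3.
have [u' [v' [T E1 E2 E3 E4]]] := triangle_oct T1 T2 T3.
have [u uE] := susp_full u'; have [v vE] := susp_full v'.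
exists u, v; split.
- apply: triangle_desusp; rewrite uE vE fmapM -compmNr //.
- apply: susp_inj; move: E2; rewrite -uE compmNl -fmapM; exact: oppr_inj.
- apply: susp_inj; move: E4; rewrite -vE compmNl compmNr -!fmapM.
  exact: oppr_inj.
by rewrite vE.
Qed.

(** Existence is enough for the vanishing arguments below, where the signs of the suspended maps are
    irrelevant. *)
Lemma triangle_suspn n a b c (f : mor a b) (g : mor b c) (h : mor c (Σ a)) :
  triangle f g h -> exists (f' : mor (suspn n a) (suspn n b))
    (g' : mor (suspn n b) (suspn n c)) (h' : mor (suspn n c) (suspn n.+1 a)),
    triangle f' g' h'.
Proof.
move=> T; elim: n => [|n [f' [g' [h' /triangle_susp T']]]]; first by exists f, g, h.
by do 3!eexists; apply: T'.
Qed.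

Lemma hom0_triangle_suspnS n x a b c (f : mor a b) (g : mor b c)
    (h : mor c (Σ a)) :
  triangle f g h -> hom0 x (suspn n c) -> hom0 x (suspn n.+1 b) ->
  hom0 x (suspn n.+1 a).
Proof.
move=> /(triangle_suspn n)[f' [g' [h' T]]] xa xc u.
by have [w ->] := triangle_exact1 T (xc (Σm f' ∘ u)); rewrite (xa w) compm0.
Qed.

Lemma hom0_triangle_suspn3 n x a b c (f : mor a b) (g : mor b c)
    (h : mor c (Σ a)) :
  triangle f g h -> hom0 x (suspn n b) -> hom0 x (suspn n.+1 a) ->
  hom0 x (suspn n c).
Proof.
move=> /(triangle_suspn n)[f' [g' [h' T]]] xa xc u.
by have [w ->] := triangle_exact3 T (xc (h' ∘ u)); rewrite (xa w) compm0.
Qed.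

End Triangulated.

(** * Covering submodules of Hom(t, c) by maps from powers of t *)

Section Covers.
Variables (k : fieldType) (C : klinear_category k).
Hypotheses (C_additive : additive_category C) (hf : hom_finite C).
Implicit Types a b c t : C.

(** Among the matrices whose row space lies in [N], one of maximal rank spans it: adding a vector of
    [N] cannot raise the rank. *)
Lemma subspace_row_span n (N : 'rV[k]_n -> Prop) :
  N 0 -> (forall r u v, N u -> N v -> N (r *: u + v)) ->
  exists A : 'M[k]_n, forall v, N v <-> (v <= A)%MS.
Proof.
move=> N0 NP; pose inN (A : 'M[k]_n) := forall v, (v <= A)%MS -> N v.
pose P m := `[< exists A, inN A /\ \rank A = m >].
have P0 : exists m, P m.
  exists 0%N; apply/asboolP; exists 0; rewrite mxrank0; split=> // v.
  by rewrite submx0 => /eqP->.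
have Pn m : P m -> (m <= n)%N.
  by move=> /asboolP[A [_ <-]]; apply: rank_leq_col.
case: (ex_maxnP P0 Pn) => m /asboolP[A [AN rA]] mmax.
exists A => v; split=> [Nv|]; last exact: AN.
have /mmax : P (\rank (A + v)%MS).
  apply/asboolP; exists (A + v)%MS; split=> // w /sub_addsmxP[[x y] ->] /=.
  have -> : y *m v = y 0 0 *: v by rewrite [y in LHS]mx11_scalar mul_scalar_mx.
  by rewrite addrC; apply: NP => //; apply: AN; apply: submxMl.
rewrite -rA (geq_leqif (mxrank_leqif_sup (addsmxSl A v))) addsmx_sub submx_refl.
by case/andP.
Qed.

(** A finite spanning family of [N] over [k] gives the components of a map $t^n \to c$; closure
    under the right action keeps its image inside [N]. *)
Lemma submodule_cover t c (N : mor t c -> Prop) :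
  N 0 -> (forall r f g, N f -> N g -> N (r *: f + g)) ->
  (forall f (a : mor t t), N f -> N (f ∘ a)) ->
  exists u (α : mor u c), add_closure t u /\
    forall x, N x <-> exists y : mor t u, x = α ∘ y.
Proof.
move=> N0 NP NΓ; have [n [[v2r v2r_lin [r2v v2rK r2vK]]]] := hf t c.
have r2v_lin : linear r2v.
  by move=> a u v; apply: (can_inj v2rK); rewrite r2vK v2r_lin !r2vK.
have r2vP r u v : r2v (r *: u + v) = r *: r2v u + r2v v := r2v_lin r u v.
have r2v0 : r2v 0 = 0.
  by have := r2v_lin (-1) 0 0; rewrite scaler0 addr0 scaleN1r addNr.
have r2vD : {morph r2v : u v / u + v}.
  by move=> u v; have := r2v_lin 1 u v; rewrite !scale1r.
have r2vZ r u : r2v (r *: u) = r *: r2v u.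
  by have := r2v_lin r u 0; rewrite r2v0 !addr0.
have [||A AP] := @subspace_row_span n (fun v => N (r2v v)).
- by rewrite r2v0.
- by move=> r u v Nu Nv; rewrite r2vP; apply: NP.
have [u du] := exists_power C_additive t n.
have [inj [prj [ii ij E]]] := du.
exists u, (\sum_i r2v (row i A) ∘ prj i); split.
  exact: (add_closure_power C_additive du).
move=> x; split=> [Nx|[y ->]].
  have /AP/submxP[D xE] : N (r2v (v2r x)) by rewrite v2rK.
  exists (\sum_i inj i ∘ (D 0 i *: idm t)).
  rewrite compm_suml -[LHS]v2rK xE mulmx_sum_row (big_morph _ r2vD r2v0).
  apply: eq_bigr => i _; rewrite compm_sumr (bigD1 i) //= big1 => [|j ne].
    by rewrite addr0 -compmA (compmA (prj i)) ii comp1m compmZr compm1 r2vZ.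
  by rewrite -compmA (compmA (prj i)) ij // comp0m compm0.
have ND f g : N f -> N g -> N (f + g).
  by move=> Nf Ng; have := NP 1 _ _ Nf Ng; rewrite scale1r.
rewrite compm_suml; elim/big_ind: _ => // i _.
by rewrite -compmA; apply/NΓ/AP; apply: row_sub.
Qed.

End Covers.

(** * Resolutions by objects of add t *)

Section Resolutions.
Variables (k : fieldType) (C : triangulated_category k).
Hypotheses (hf : hom_finite C) (spl : split_idempotents C).
Variable t : C.
Implicit Types a b c x y z u v : C.

Let C_additive := tri_additive C.
Local Notation Σ := (susp C).
Local Notation T := (add_closure t).

(** Total on objects, with value 0 outside [T], so that classes can be written without carrying
    membership proofs. *)
Definition addK0 x : K0sp T :=
  if pselect (T x) is left p then K0sp_class (exist T x p) else 0.

Lemma addK0E (x : full_sub T) : addK0 (sval x) = K0sp_class x.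
Proof.
case: x => x Tx /=; rewrite /addK0; case: pselect => // Tx'.
by rewrite (Prop_irrelevance Tx Tx').
Qed.

Lemma addK0_sum a b c : direct_sum a b c -> T a -> T b ->
  addK0 c = addK0 a + addK0 b.
Proof.
move=> ds Ta Tb; have Tc := add_closure_sum C_additive spl ds Ta Tb.
rewrite (addK0E (exist T a Ta)) (addK0E (exist T b Tb)) (addK0E (exist T c Tc)).
apply: presented_relB.
by exists (exist T a Ta), (exist T b Tb), (exist T c Tc).
Qed.

Lemma addK0_zero z : zero_object z -> addK0 z = 0.
Proof.
move=> z0; have Tz := add_closure_zero C_additive t spl z0.
apply: (addrI (addK0 z)).
by rewrite addr0 -(addK0_sum (direct_sum0 z z0) Tz Tz).
Qed.

Definition ghost a b (h : mor a b) := forall x : mor t a, h ∘ x = 0.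

Lemma ghost_add a b (h : mor a b) : T a -> ghost h -> h = 0.
Proof. exact: add_closure_eq0. Qed.

Lemma ghost_precomp a b c (g : mor b c) (h : mor a b) : ghost g -> ghost (g ∘ h).
Proof. by move=> g0 x; rewrite -compmA g0. Qed.

Lemma ghost_lift a b c (f : mor a b) (g : mor b c) (h : mor c (Σ a))
    (x : mor t c) : triangle f g h -> ghost h -> exists y : mor t b, x = g ∘ y.
Proof. by move=> tr h0; apply: triangle_exact3 tr (h0 x). Qed.

Lemma surj_ghost a b c (f : mor a b) (g : mor b c) (h : mor c (Σ a)) :
  triangle f g h -> (forall x : mor t c, exists y : mor t b, x = g ∘ y) -> ghost h.
Proof.
move=> tr gs x; have [y ->] := gs x.
by rewrite compmA (triangle_comp23 tr) comp0m.
Qed.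

Lemma exists_precover c : exists c' x (f : mor c' x) (g : mor x c)
  (h : mor c (Σ c')), [/\ T x, triangle f g h & ghost h].
Proof.
have [//|//|//|x [g [Tx gP]]] :=
  @submodule_cover k C C_additive hf t c (fun _ => True).
have [c' [f [h tr]]] := triangle_cocone g.
exists c', x, f, g, h; split=> //; apply: surj_ghost tr _ => y.
by have /gP := I.
Qed.

(** Here [n] counts precovers, so there are [n.+1] terms of [T], and [ζ] is their alternating sum.
    That [h] is ghost says that [g] is a precover. *)
Fixpoint resolution n c (ζ : K0sp T) : Prop :=
  match n with
  | 0 => T c /\ ζ = addK0 c
  | n'.+1 => exists c' x (f : mor c' x) (g : mor x c) (h : mor c (Σ c')) ζ',
      [/\ T x, triangle f g h, ghost h, resolution n' c' ζ' & ζ = addK0 x - ζ']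
  end.

Lemma resolution_add n c : T c -> resolution n c (addK0 c).
Proof.
have [z z0] := C_additive.1; elim: n c => // n IH c Tc /=.
exists z, c, 0, (idm c), 0, 0; split=> //; last by rewrite subr0.
- exact: triangle_zero_id.
- by move=> x; rewrite comp0m.
rewrite -(addK0_zero z0); apply: IH; exact: add_closure_zero.
Qed.

Lemma resolutionS n c ζ : resolution n c ζ -> resolution n.+1 c ζ.
Proof.
elim: n c ζ => [|n IH] c ζ; first by case=> Tc ->; apply: resolution_add.
case=> c' [x [f [g [h [ζ' [Tx tr h0 /IH rz ->]]]]]].
by exists c', x, f, g, h, ζ'.
Qed.

Lemma resolution_leq m n c ζ : (m <= n)%N -> resolution m c ζ -> resolution n c ζ.
Proof.
move=> /subnK <-; elim: (n - m)%N => // i IH r.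
by rewrite addSn; apply: resolutionS; apply: IH.
Qed.

(** The precover is pulled back along [π]; the octahedron exhibits the new middle term as an
    extension of [x] by [a] with zero connecting map. *)
Lemma precover_sum c p a c' x (π : mor p c) (i : mor a p)
    (f : mor c' x) (g : mor x c) (h : mor c (Σ c')) :
  T x -> T a -> triangle f g h -> ghost h -> triangle i π (0 : mor c (Σ a)) ->
  exists y (f' : mor c' y) (g' : mor y p) (h' : mor p (Σ c')),
  [/\ T y, triangle f' g' h', ghost h' & addK0 y = addK0 x + addK0 a].
Proof.
move=> Tx Ta tr h0 tr0; have [y [f' [g' tr']]] := triangle_fibre (h ∘ π).
have [u [v [tr'' _ _ _]]] := octahedron_cocone tr0 (triangle_rotl tr)
  (triangle_rotl tr').
rewrite comp0m in tr''; have ds := triangle_split_sum tr''.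
exists y, f', g', (h ∘ π); split=> //.
- exact: add_closure_sum ds Ta Tx.
- exact: ghost_precomp.
by rewrite (addK0_sum ds) // addrC.
Qed.

End Resolutions.

(** * Uniqueness and additivity of the alternating sum of a resolution *)

Section Schanuel.
Variables (k : fieldType) (C : triangulated_category k).
Hypotheses (hf : hom_finite C) (spl : split_idempotents C).
Variable t : C.
Implicit Types a b c x y z u v : C.

Let C_additive := tri_additive C.
Local Notation Σ := (susp C).
Local Notation T := (add_closure t).
Local Notation "'[' x ']'" := (addK0 t x).

(** Both sums are realised by a weak pullback of [g] and [g']: each ghost map vanishes after
    composition with the other precover, so both projections split. *)
Lemma schanuel c' x (f : mor c' x) c (g : mor x c) (h : mor c (Σ c'))
    c'' u (f' : mor c'' u) (g' : mor u c) (h' : mor c (Σ c'')) :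
  T x -> T u -> triangle f g h -> triangle f' g' h' ->
  ghost t h -> ghost t h' ->
  exists p, direct_sum x c'' p /\ direct_sum u c' p.
Proof.
move=> Tx Tu tr tr' h0 h'0.
have [p [i [π trp]]] := triangle_fibre (0 : mor x (Σ c'')).
exists p; split; first exact/direct_sumC/(triangle_split_sum trp).
have tr3 := triangle_rotl trp.
have hg : 0 = h' ∘ g by rewrite (ghost_add Tx (ghost_precomp g h'0)).
rewrite hg in tr3.
have [m [n [tr'' _ _ _]]] := octahedron_cocone tr (triangle_rotl tr') tr3.
rewrite (ghost_add Tu (ghost_precomp g' h0)) in tr''.
exact/direct_sumC/(triangle_split_sum tr'').
Qed.

Lemma resolution_sum n a c p (ζ : K0sp T) : direct_sum a c p -> T a ->
  resolution n c ζ -> resolution n p (ζ + [a]).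
Proof.
case: n => [|n] ds Ta /=.
  move=> [Tc ->]; split; last by rewrite (addK0_sum spl ds) // addrC.
  exact: add_closure_sum ds Ta Tc.
case=> c' [x [f [g [h [ζ' [Tx tr h0 r ->]]]]]].
have [i [π tr0]] := direct_sum_triangle ds.
have [y [f' [g' [h' [Ty tr' h'0 E]]]]] := precover_sum spl Tx Ta tr h0 tr0.
by exists c', y, f', g', h', ζ'; split=> //; rewrite E addrAC.
Qed.

(** The two claims feed each other. Cancelling a summand at length [n] gives the syzygy claim
    through Schanuel's lemma, and this gives cancellation at length [n.+1] by adding [a] to a
    precover of [c]. *)
Lemma resolution_summand_syzygy n :
  (forall a c p (ζ : K0sp T), direct_sum a c p -> T a ->
     resolution n p ζ -> resolution n c (ζ - [a])) /\
  (forall c c' u (f : mor c' u) (g : mor u c) (h : mor c (Σ c')) (ζ : K0sp T),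
     resolution n.+1 c ζ -> T u -> triangle f g h -> ghost t h ->
     resolution n c' ([u] - ζ)).
Proof.
have syz m : (forall a c p (ζ : K0sp T), direct_sum a c p -> T a ->
     resolution m p ζ -> resolution m c (ζ - [a])) ->
  forall c c' u (f : mor c' u) (g : mor u c) (h : mor c (Σ c')) (ζ : K0sp T),
     resolution m.+1 c ζ -> T u -> triangle f g h -> ghost t h ->
     resolution m c' ([u] - ζ).
  move=> summ c c'' u f' g' h' ζ [c' [x [f [g [h [ζ' [Tx tr h0 r ->]]]]]]].
  move=> Tu tr' h'0.
  have [p [ds ds']] := schanuel Tx Tu tr tr' h0 h'0.
  have := summ _ _ _ _ ds Tx (resolution_sum ds' Tu r).
  by rewrite opprB addrA [ζ' + _]addrC.
elim: n => [|n [_ IH]].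
  suff summ : forall a c p (ζ : K0sp T), direct_sum a c p -> T a ->
    resolution 0 p ζ -> resolution 0 c (ζ - [a]) by split=> //; apply: syz.
  move=> a c p ζ ds Ta [Tp ->].
  have Tc := add_closure_summand C_additive spl (direct_sumC ds) Tp.
  by split=> //; rewrite (addK0_sum spl ds) // addrAC subrr add0r.
suff summ : forall a c p (ζ : K0sp T), direct_sum a c p -> T a ->
  resolution n.+1 p ζ -> resolution n.+1 c (ζ - [a]) by split=> //; apply: syz.
move=> a c p ζ ds Ta r.
have [c' [x [f [g [h [Tx tr h0]]]]]] := exists_precover hf t c.
have [i [π tr0]] := direct_sum_triangle ds.
have [y [f' [g' [h' [Ty tr' h'0 E]]]]] := precover_sum spl Tx Ta tr h0 tr0.
exists c', x, f, g, h, ([y] - ζ); split=> //; first exact: IH tr' h'0.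
by rewrite opprB E addrCA opprD (addrA (addK0 t x)) subrr add0r.
Qed.

Lemma resolution_syzygy n c c' u (f : mor c' u) (g : mor u c)
    (h : mor c (Σ c')) (ζ : K0sp T) :
  resolution n.+1 c ζ -> T u -> triangle f g h -> ghost t h ->
  resolution n c' ([u] - ζ).
Proof. exact: (resolution_summand_syzygy n).2. Qed.

Lemma resolution_pred n c c' u (f : mor c' u) (g : mor u c)
    (h : mor c (Σ c')) (ζ : K0sp T) :
  resolution n c ζ -> T u -> triangle f g h -> ghost t h ->
  resolution n.-1 c' ([u] - ζ).
Proof.
case: n => [|n] r; last exact: resolution_syzygy.
exact/resolution_syzygy/(resolutionS spl r).
Qed.

(** One common precover reduces both resolutions to its syzygy. *)
Lemma resolution_inj n c (ζ ζ' : K0sp T) :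
  resolution n c ζ -> resolution n c ζ' -> ζ = ζ'.
Proof.
elim: n c ζ ζ' => [|n IH] c ζ ζ'; first by move=> [_ ->] [_ ->].
move=> r r'; have [c' [x [f [g [h [Tx tr h0]]]]]] := exists_precover hf t c.
have := IH _ _ _ (resolution_syzygy r Tx tr h0) (resolution_syzygy r' Tx tr h0).
by move/addrI/oppr_inj.
Qed.

(** Separate lengths for the three terms let a rotation lower two of them at a time. *)
Definition additive_at la lb lc := forall a b c (f : mor a b) (g : mor b c)
  (h : mor c (Σ a)) (ζa ζb ζc : K0sp T), triangle f g h -> ghost t h ->
  resolution la a ζa -> resolution lb b ζb -> resolution lc c ζc ->
  ζb = ζa + ζc.

(* Rotating (a, b, c) to (Ωb, Ωc, a), where Ω takes the fibre of a
   precover, replaces the 3x3 lemma by the octahedral axiom. *)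
Lemma additive_at_rot la lb lc :
  additive_at lb.-1 lc.-1 la -> additive_at la lb lc.
Proof.
move=> IH a b c f g h ζa ζb ζc tr h0 ra rb rc.
have [b' [x [i [π [κ [Tx trb κ0]]]]]] := exists_precover hf t b.
have [c' [j [δ trc]]] := triangle_cocone (g ∘ π).
have δ0 : ghost t δ.
  apply: (surj_ghost trc) => y.
  have [v ->] := ghost_lift y tr h0; have [w ->] := ghost_lift v trb κ0.
  by exists w; rewrite compmA.
have [u [v [tr' _ _ _]]] := octahedron_cocone trb tr trc.
have := IH _ _ _ _ _ _ _ _ _ tr' (ghost_precomp f κ0)
  (resolution_pred rb Tx trb κ0) (resolution_pred rc Tx trc δ0) ra.
move/(congr1 (fun w => ζb + (w - [x]) + ζc)).
have e w : addK0 t x + w - addK0 t x = w by rewrite addrAC subrr add0r.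
by rewrite -(addrA _ (- ζb)) !e subrK addNKr.
Qed.

Lemma additive_atW la lb lc la' lb' lc' :
  (la' <= la)%N -> (lb' <= lb)%N -> (lc' <= lc)%N ->
  additive_at la lb lc -> additive_at la' lb' lc'.
Proof.
move=> la_ lb_ lc_ A a b c f g h ζa ζb ζc tr h0 ra rb rc.
by apply: (A _ _ _ _ _ _ _ _ _ tr h0); apply: resolution_leq; eauto.
Qed.

Lemma resolution_additive n : additive_at n n n.
Proof.
elim: n => [|n IH].
  move=> a b c f g h ζa ζb ζc tr h0 [Ta ->] [Tb ->] [Tc ->].
  rewrite (ghost_add Tc h0) in tr.
  exact: addK0_sum (triangle_split_sum tr) Ta Tc.
(* The lengths $(n+1, n+1, n+1)$ become $(n, n, n+1)$ and then $(n-1, n, n)$, with truncated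
   subtraction, which the induction hypothesis covers. *)
apply/additive_at_rot/additive_at_rot.
by apply: additive_atW IH => //=; apply: leq_pred.
Qed.

End Schanuel.

(** * The index of an object of the triangulated category *)

Section Suspn.
Variables (k : fieldType) (C : triangulated_category k).
Implicit Types a b c x y z u v : C.

Fixpoint suspn_map n a b (f : mor a b) : mor (suspn n a) (suspn n b) :=
  if n is n'.+1 then fmap (susp C) (suspn_map n' f) else f.

Lemma suspn_map_id n a : suspn_map n (idm a) = idm (suspn n a).
Proof. by elim: n => //= n ->; rewrite fmap1. Qed.

Lemma suspn_map_comp n a b c (g : mor b c) (f : mor a b) :
  suspn_map n (g ∘ f) = suspn_map n g ∘ suspn_map n f.
Proof. by elim: n => //= n ->; rewrite fmapM. Qed.

Lemma suspn_mapD n a b (f g : mor a b) :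
  suspn_map n (f + g) = suspn_map n f + suspn_map n g.
Proof. by elim: n => //= n ->; rewrite suspD. Qed.

Lemma suspn_map0 n a b : suspn_map n (0 : mor a b) = 0.
Proof. by elim: n => //= n ->; rewrite susp0. Qed.

Lemma suspnD m n c : suspn (m + n) c = suspn m (suspn n c).
Proof. exact: iterD. Qed.

Lemma hom0_suspn_add t n s x : add_closure t x ->
  hom0 s (suspn n t) -> hom0 s (suspn n x).
Proof.
move=> /add_closure_factors[r [q [p E]]] st f.
rewrite -[f]comp1m -suspn_map_id E.
rewrite (big_morph _ (@suspn_mapD n x x) (suspn_map0 n x x)).
rewrite compm_suml big1 // => j _.
by rewrite suspn_map_comp -compmA (st (_ ∘ f)) compm0.
Qed.

End Suspn.

Lemma big_alt_recl (G : zmodType) n (F : nat -> G) :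
  \sum_(i < n.+1) F i *~ (-1) ^+ i =
  F 0%N - \sum_(i < n) F i.+1 *~ (-1) ^+ i.
Proof.
rewrite big_ord_recl expr0; congr (_ + _); rewrite -sumrN.
by apply: eq_bigr => i _; rewrite exprS mulN1r mulrNz.
Qed.

(** * Rigidity of t and resolutions of arbitrary objects *)

Section Index.
Variables (k : fieldType) (C : triangulated_category k).
Hypotheses (hf : hom_finite C) (spl : split_idempotents C).
Variables (m : nat) (S : C -> Prop) (t : C).
Hypotheses (S_ct : cluster_tilting m.+1 S) (S_stable : suspn_stable m.+1 S)
  (t_ct : OT_cluster_tilting m.+1 S t).
Implicit Types a b c x y z u v : C.

Let C_additive := tri_additive C.
Local Notation Σ := (susp C).
Local Notation T := (add_closure t).
Local Notation "'[' x ']'" := (addK0 t x).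
(** With $d = m + 1$ this is $2d - 1$, the top degree of the vanishing range of [t]. *)
Local Notation N := (m + m.+1)%N.

Lemma tilting_hom0 s s' i : S s -> S s' -> (0 < i <= m)%N -> hom0 s (suspn i s').
Proof.
case: S_ct => [_ ctP _] Ss Ss' im f.
by move: Ss' => /ctP H; apply: (H s).
Qed.

Lemma tiltingP c :
  (forall s i, S s -> (0 < i <= m)%N -> hom0 s (suspn i c)) -> S c.
Proof. by case: S_ct => [_ ctP _] H; apply/ctP => s i Ss im f; apply: H. Qed.

Lemma add_closure_tilting x : T x -> S x.
Proof.
have [St _ _] := t_ct => Tx; apply: tiltingP => s i Ss im.
exact/(hom0_suspn_add Tx)/tilting_hom0.
Qed.

Lemma suspn_tilting s : S s -> S (suspn m.+1 s).
Proof.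
by move=> Ss; apply/S_stable; exists s; split=> //; exists (idm _); apply: is_iso_id.
Qed.

Lemma hom0_rigid j : (0 < j <= N)%N -> hom0 t (suspn j t).
Proof.
have [St t0 _] := t_ct => jN.
have [jm|mj|->] := ltngtP j m.+1; last exact: t0.
  by apply: tilting_hom0 => //; lia.
have -> : j = (j - m.+1 + m.+1)%N by lia.
by rewrite suspnD; apply: tilting_hom0 => //; [apply: suspn_tilting | lia].
Qed.

Lemma hom0_add j x : T x -> (0 < j <= N)%N -> hom0 t (suspn j x).
Proof. by move=> Tx /hom0_rigid; apply: hom0_suspn_add. Qed.

(** Each triangle moves the question about [y] one degree down to the next intermediate object; the
    strict inequality keeps the degree positive down to the last term. *)
Lemma tower_hom0_from n l x (xs : nat -> C) y (xi : forall j, mor (xs j.+1) (xs j))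
    (eps : mor (xs 0%N) y) (gam : mor y (suspn n.+1 (xs n.+1))) :
  triangle_tower xi eps gam -> (forall j, (j <= n.+1)%N -> T (xs j)) ->
  (n.+1 < l)%N -> (forall i, (0 < i <= l)%N -> hom0 t (suspn i x)) ->
  hom0 y (suspn l x).
Proof.
have step l' a u (f : mor a u) b (g : mor u b) (h : mor b (Σ a)) :
    triangle f g h -> T u -> hom0 a (suspn l' x) ->
    hom0 t (suspn l'.+1 x) -> hom0 b (suspn l'.+1 x).
  move=> tr Tu ax tx r.
  have [|w ->] := triangle_coexact3 (u := r) tr.
    by apply: add_closure_eq0 Tu _ => w; apply: tx.
  by have [w' <-] := susp_full w; rewrite (ax w') susp0 comp0m.
elim: n l xs y xi eps gam => [|n IH] [//|l] xs y xi eps gam.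
  move=> /= tr Txs l1 xV; apply: step tr _ _ _; [exact: Txs| |apply: xV; lia].
  move=> r; apply: add_closure_eq0 (Txs 1%N _) _ => // w.
  by apply: xV; lia.
move=> /= [v [f [e [g [gam' [tr _ tow _]]]]]] Txs l1 xV.
apply: step tr _ _ _; [exact: Txs| |apply: xV; lia].
apply: IH tow _ _ _; [|by []|].
  by move=> j jn; apply: (Txs j.+1).
by move=> i il; apply: xV; lia.
Qed.

(** Each triangle raises the degree by one, ending at $\Sigma^{j+n+1}$ of the last term, hence the
    bound by [N]. *)
Lemma tower_hom0_to n j (xs : nat -> C) y (xi : forall j, mor (xs j.+1) (xs j))
    (eps : mor (xs 0%N) y) (gam : mor y (suspn n.+1 (xs n.+1))) :
  triangle_tower xi eps gam -> (forall j, (j <= n.+1)%N -> T (xs j)) ->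
  (0 < j)%N -> (j + n.+1 <= N)%N -> hom0 t (suspn j y).
Proof.
elim: n j xs y xi eps gam => [|n IH] j xs y xi eps gam /=.
  move=> tr Txs j0 jN; apply: hom0_triangle_suspn3 tr _ _.
    by apply: hom0_add; [exact: Txs | lia].
  by apply: hom0_add; [exact: Txs | lia].
move=> [v [f [e [g [gam' [tr _ tow _]]]]]] Txs j0 jN.
apply: hom0_triangle_suspn3 tr _ _.
  by apply: hom0_add; [exact: Txs | lia].
apply: (IH j.+1 _ _ _ _ _ tow) => //; last by lia.
by move=> i ii; apply: (Txs i.+1).
Qed.

(** The triangles of the tower are precover triangles, because [t] has no nonzero map into the
    suspension of any of the fibres. *)
Lemma tower_resolution n (xs : nat -> C) y (xi : forall j, mor (xs j.+1) (xs j))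
    (eps : mor (xs 0%N) y) (gam : mor y (suspn n.+1 (xs n.+1))) :
  triangle_tower xi eps gam -> (forall j, (j <= n.+1)%N -> T (xs j)) ->
  (n <= m)%N ->
  resolution n.+1 y (\sum_(j < n.+2) addK0 t (xs j) *~ (-1) ^+ j).
Proof.
elim: n xs y xi eps gam => [|n IH] xs y xi eps gam.
  move=> /= tr Txs _; exists (xs 1%N), (xs 0%N), (xi 0%N), eps, gam, [xs 1%N].
  split=> //; [exact: Txs| | |].
  - by move=> f; apply: (@hom0_add 1%N); [exact: Txs | lia].
  - by split=> //; apply: Txs.
  by rewrite (big_alt_recl _ (fun j => [xs j])) big_ord1.
move=> /= [v [f [e [g [gam' [tr _ tow _]]]]]] Txs nm.
exists v, (xs 0%N), f, eps, g, (\sum_(j < n.+2) [xs j.+1] *~ (-1) ^+ j).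
have Txs' j : (j <= n.+1)%N -> T (xs j.+1) by move=> jn; apply: (Txs j.+1).
split=> //; [exact: Txs| | |].
- by move=> w; apply: (tower_hom0_to (j := 1%N) tow); [by []|by []|lia].
- by apply: IH tow _ _; [by []|lia].
by rewrite (big_alt_recl _ (fun j => [xs j])).
Qed.

Lemma OT_resolution s : S s -> exists ζ, resolution (t := t) m.+1 s ζ.
Proof.
have [_ _ OT] := t_ct => /OT[xs [xi [eps [gam [Txs [_ _ tow]]]]]].
by eexists; apply: tower_resolution tow _ _.
Qed.

(* Σ^m.+1 x is in S and has zero maps from t, so that 0 is a precover of it, and its
   iterated syzygies are the desuspensions, ending with x. *)
Lemma hom0_add_closure x :
  (forall j, (0 < j <= N)%N -> hom0 t (suspn j x)) -> T x.
Proof.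
move=> xV; have Sx : S (suspn m.+1 x).
  apply: tiltingP => s i Ss im; rewrite -suspnD.
  have [_ _ /(_ _ Ss)[xs [xi [eps [gam [Txs [_ _ tow]]]]]]] := t_ct.
  by apply: tower_hom0_from tow _ _ _ => //; [lia | move=> j ji; apply: xV; lia].
have : (m.+1 <= N)%N by lia.
have [ζ] := OT_resolution Sx; move: (N) xV => M xV.
elim: m.+1 ζ => [|n IH] ζ; first by case.
move=> r nN; have [z z0] := C_additive.1.
have Tz := add_closure_zero C_additive t spl z0.
apply: IH (ltnW nN); apply: (resolution_syzygy hf spl r Tz).
  exact: triangle_id_shift z0.
by move=> w; rewrite (xV n.+1 _ w) ?compm0.
Qed.

(** Each syzygy gains one degree of vanishing, and once all degrees up to [N] vanish it lies in [T].
    For $i = 0$ nothing is required of [c]. *)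
Lemma resolution_exists_from r i c : (r + i = N)%N ->
  (forall j, (0 < j <= i)%N -> hom0 t (suspn j c)) ->
  exists ζ, resolution (t := t) r c ζ.
Proof.
elim: r i c => [|r IH] i c riN cV.
  by exists [c]; split=> //; apply: hom0_add_closure; rewrite -riN.
have [c' [x [f [g [h [Tx tr h0]]]]]] := exists_precover hf t c.
have c'V j : (0 < j <= i.+1)%N -> hom0 t (suspn j c').
  case: j => [//|[|j]] ji.
    (* In degree one, the ghost connecting map of the precover takes the place of a vanishing
       condition on [c]. *)
    move=> u; have [|w ->] := triangle_exact1 (u := u) tr; last exact: h0.
    by apply: (@hom0_add 1%N); [|lia].
  apply: hom0_triangle_suspnS tr _ _; first by apply: cV; lia.
  by apply: hom0_add => //; lia.
have [|ζ r'] := IH i.+1 c' _ c'V; first by lia.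
by exists ([x] - ζ), c', x, f, g, h, ζ.
Qed.

Lemma resolution_exists c : exists ζ, resolution (t := t) N c ζ.
Proof.
by apply: (@resolution_exists_from _ 0%N); [rewrite addn0 | case].
Qed.

Definition tilting_index c : K0sp T := sval (cid (resolution_exists c)).

Lemma tilting_indexP c : resolution N c (tilting_index c).
Proof. exact: svalP (cid (resolution_exists c)). Qed.

Lemma tilting_index_resolution n c ζ : (n <= N)%N -> resolution n c ζ -> tilting_index c = ζ.
Proof.
move=> nN /(resolution_leq spl nN); apply: resolution_inj => //.
exact: tilting_indexP.
Qed.

Lemma tilting_index_additive a b c (f : mor a b) (g : mor b c) (h : mor c (Σ a)) :
  triangle f g h -> ghost t h -> tilting_index b = tilting_index a + tilting_index c.
Proof.
move=> tr h0.
by apply: (resolution_additive hf spl tr h0); apply: tilting_indexP.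
Qed.

End Index.

(** * The error term as a function of a module *)

Lemma linear_lift (R : pzRingType) (P M' M : lmodType R) (f : {linear M' -> M})
    (p : {linear P -> M}) :
  injective f -> (forall x, exists y, f y = p x) ->
  exists q : {linear P -> M'}, forall x, f (q x) = p x.
Proof.
move=> fI /choice[q qE]; have ql : linear q.
  by move=> r x y; apply: fI; rewrite linearP !qE linearP.
pose Q := GRing.isLinear.Build R P M' _ q ql.
pose q' : {linear P -> M'} := HB.pack q Q.
by exists q'.
Qed.

Section ErrorTerm.
Variables (k : fieldType) (C : triangulated_category k).
Hypothesis hf : hom_finite C.
Variable t : C.
Variables (G : zmodType) (ind : C -> G).
Hypothesis ind_additive : forall (a b c : C) (f : mor a b) (g : mor b c)
  (h : mor c (susp C a)), triangle f g h -> ghost t h -> ind b = ind a + ind c.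
Implicit Types a b c x y z u v : C.

Let C_additive := tri_additive C.
Local Notation Σ := (susp C).
Local Notation T := (add_closure t).

(** The failure of [ind] to be additive on a triangle with these terms; it becomes the value of the
    error homomorphism on the image of the connecting map. *)
Definition defect a b c := ind a - ind b + ind c.

Lemma defect_ghost a b c (f : mor a b) (g : mor b c) (h : mor c (Σ a)) :
  triangle f g h -> ghost t h -> defect a b c = 0.
Proof.
by move=> tr /(ind_additive tr) E; rewrite /defect E opprD addNKr addNr.
Qed.

(** The octahedron for $h\alpha$ yields a triangle $l \to b_1 \to b$ with connecting map $\kappa g$,
    so that [ind b1 = ind l + ind b]. *)
Lemma defect_comp a b c l c1 b1
    (f : mor a b) (g : mor b c) (h : mor c (Σ a))
    (m : mor l c1) (α : mor c1 c) (κ : mor c (Σ l))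
    (f1 : mor a b1) (g1 : mor b1 c1) :
  triangle f g h -> triangle m α κ -> triangle f1 g1 (h ∘ α) ->
  ghost t (κ ∘ g) -> defect a b c = defect a b1 c1 + defect l c1 c.
Proof.
move=> tr trα tr1 κg.
have [u [v [tr' _ _ _]]] :=
  octahedron_cocone trα (triangle_rotl tr) (triangle_rotl tr1).
rewrite /defect (ind_additive tr' κg) (addrAC (ind l)) (addrACA _ (ind c1)).
by rewrite subrr addr0 opprD [- ind l - _]addrC !addrA subrK.
Qed.

Lemma defect_precomp a b c l c1 b1
    (f : mor a b) (g : mor b c) (h : mor c (Σ a))
    (m : mor l c1) (α : mor c1 c) (κ : mor c (Σ l))
    (f1 : mor a b1) (g1 : mor b1 c1) :
  triangle f g h -> triangle m α κ -> triangle f1 g1 (h ∘ α) ->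
  ghost t κ -> defect a b c = defect a b1 c1.
Proof.
move=> tr trα tr1 κ0.
rewrite (defect_comp tr trα tr1 (ghost_precomp g κ0)).
by rewrite (defect_ghost trα κ0) addr0.
Qed.

(** Both $h\alpha$ and $\kappa g$ are ghost, because the image of $\operatorname{Hom}(t,\alpha)$ is
    the kernel of $\operatorname{Hom}(t,h)$; in [defect_comp] only the triangle on [α] then
    contributes. *)
Lemma defect_kernel_cone a b c l u (f : mor a b) (g : mor b c) (h : mor c (Σ a))
    (m : mor l u) (α : mor u c) (κ : mor c (Σ l)) :
  triangle f g h -> triangle m α κ ->
  (forall x : mor t c, h ∘ x = 0 <-> exists y : mor t u, x = α ∘ y) ->
  defect a b c = defect l u c.
Proof.
move=> tr trα ker.
have [b1 [f1 [g1 tr1]]] := triangle_fibre (h ∘ α).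
rewrite (defect_comp tr trα tr1) => [|x].
  rewrite (defect_ghost tr1) ?add0r // => y.
  by rewrite -compmA; apply/ker; exists y.
have /ker[y gxE] : h ∘ (g ∘ x) = 0 by rewrite compmA (triangle_comp23 tr) comp0m.
by rewrite -compmA gxE compmA (triangle_comp23 trα) comp0m.
Qed.

Lemma kernel_cover c y (h : mor c y) : exists u (α : mor u c),
  add_closure t u /\ forall x : mor t c,
    h ∘ x = 0 <-> exists w : mor t u, x = α ∘ w.
Proof.
apply: (submodule_cover C_additive hf).
- exact: compm0.
- by move=> r f g f0 g0; rewrite compmDr compmZr f0 g0 scaler0 addr0.
- by move=> f r f0; rewrite compmA f0 comp0m.
Qed.

Lemma defect_kernel a b c (f : mor a b) (g : mor b c) (h : mor c (Σ a))
    a' b' (f' : mor a' b') (g' : mor b' c) (h' : mor c (Σ a')) :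
  triangle f g h -> triangle f' g' h' ->
  (forall x : mor t c, h ∘ x = 0 <-> h' ∘ x = 0) ->
  defect a b c = defect a' b' c.
Proof.
move=> tr tr' hh'; have [u [α [_ ker]]] := kernel_cover h.
have [l [m [κ trα]]] := triangle_cocone α.
rewrite (defect_kernel_cone tr trα) //; apply/esym.
by apply: (defect_kernel_cone tr' trα) => x; rewrite -hh'.
Qed.

(** Encodes $M \cong \operatorname{Im}\operatorname{Hom}(t,h)$ by a surjection from
    $\operatorname{Hom}(t,c)$ with the same kernel, which avoids forming the image. *)
Definition presents (M : fgmod (endo t)) c y (h : mor c y) :=
  exists π : {linear hom_mod hf t c -> M},
    (forall w : M, exists x : mor t c, π x = w) /\
    forall x : mor t c, π x = 0 <-> h ∘ x = 0.

(** A scalar of [k] acts on $\operatorname{Hom}(t,c)$ as the endomorphism $r \cdot 1_t$, so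
    linearity over the endomorphism ring covers it. *)
Lemma hom_mod_linearZ (M : fgmod (endo t)) c (π : {linear hom_mod hf t c -> M})
    (r : k) (f : mor t c) :
  π (r *: f : mor t c) = (r *: idm t : (endo t)^c) *: π f :> M.
Proof.
rewrite -[LHS]/(π (r *: f : mor t c)) -[f in LHS]compm1 -compmZr.
exact: (linearZ_LR π (r *: idm t : (endo t)^c) (f : hom_mod hf t c)).
Qed.

Lemma hom_mod_linearD (M : fgmod (endo t)) c (π : {linear hom_mod hf t c -> M})
    (f g : mor t c) :
  π (f + g : mor t c) = π f + π g.
Proof. exact: (raddfD π). Qed.

Lemma hom_mod_linearM (M : fgmod (endo t)) c (π : {linear hom_mod hf t c -> M})
    (f : mor t c) (a : mor t t) :
  π (f ∘ a : mor t c) = (a : (endo t)^c) *: π f :> M.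
Proof. exact: (linearZ_LR π (a : (endo t)^c) (f : hom_mod hf t c)). Qed.

Lemma hom_mod_linear0 (M : fgmod (endo t)) c (π : {linear hom_mod hf t c -> M}) :
  π (0 : mor t c) = 0.
Proof. exact: (raddf0 π). Qed.

Lemma linear_kernel_cover (M : fgmod (endo t)) c
    (π : {linear hom_mod hf t c -> M}) :
  exists u (α : mor u c), add_closure t u /\ forall x : mor t c,
    π x = 0 <-> exists w : mor t u, x = α ∘ w.
Proof.
apply: (submodule_cover C_additive hf (N := fun f => π f = 0)).
- exact: hom_mod_linear0.
- move=> r f g f0 g0.
  by rewrite hom_mod_linearD hom_mod_linearZ f0 g0 scaler0 addr0.
- by move=> f a f0; rewrite hom_mod_linearM f0 scaler0.
Qed.

(** Generators of [M] give a surjection from $\operatorname{Hom}(t,t^n)$ whose kernel is covered by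
    [g]; by exactness the next map [h] has the same kernel on maps from [t]. *)
Lemma exists_presentation (M : fgmod (endo t)) :
  exists a b c (f : mor a b) (g : mor b c) (h : mor c (Σ a)),
    [/\ T b, T c, triangle f g h & presents M h].
Proof.
have [n [e eP]] := fg_finite M.
have [c dc] := exists_power C_additive t n.
have [inj [prj [ii ij E]]] := dc.
pose p (x : hom_mod hf t c) : M :=
  \sum_i (prj i ∘ (x : mor t c) : (endo t)^c) *: e i.
have pl : linear p.
  move=> r x y; rewrite /p scaler_sumr -big_split; apply: eq_bigr => i _ /=.
  rewrite scalerA -scalerDl; congr (_ *: _).
  rewrite [LHS]compmDr; congr (_ + _); exact: compmA.
pose P := GRing.isLinear.Build _ _ _ _ p pl.
pose π : {linear hom_mod hf t c -> M} := HB.pack p P.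
have [b [g [Tb ker]]] := linear_kernel_cover π.
have [a [f [h tr]]] := triangle_cocone g.
exists a, b, c, f, g, h; split=> //.
  exact: (add_closure_power C_additive dc).
exists π; split=> [w|x].
  have [r ->] := eP w; exists (\sum_i inj i ∘ (r i : mor t t)).
  apply: eq_bigr => i _; congr (_ *: _).
  rewrite compm_sumr (bigD1 i) //= big1 => [|j ne].
    by rewrite addr0 compmA ii comp1m.
  by rewrite compmA ij // comp0m.
rewrite ker; split=> [[w ->]|]; first by rewrite compmA (triangle_comp23 tr) comp0m.
exact: triangle_exact3 tr.
Qed.

(* Both triangles are pulled back along a cover of the fibre product of the two
   presentations, where the resulting maps have the same kernel. *)
Lemma defect_presents (M : fgmod (endo t))
    a b c (f : mor a b) (g : mor b c) (h : mor c (Σ a))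
    a' b' c' (f' : mor a' b') (g' : mor b' c') (h' : mor c' (Σ a')) :
  triangle f g h -> triangle f' g' h' -> presents M h -> presents M h' ->
  defect a b c = defect a' b' c'.
Proof.
move=> tr tr' [π [πs πk]] [π' [πs' πk']].
have [s [i1 [i2 [p1 [p2 [p11 p22 p12 p21 E]]]]]] := C_additive.2 c c'.
have [|||u [α [Tu αP]]] := submodule_cover C_additive hf
    (N := fun x : mor t s => π (p1 ∘ x) = π' (p2 ∘ x)).
- by rewrite !compm0 !hom_mod_linear0.
- move=> r x y xE yE.
  by rewrite !compmDr !compmZr !hom_mod_linearD !hom_mod_linearZ xE yE.
- by move=> x r xE; rewrite !compmA !hom_mod_linearM xE.
have surj1 (x : mor t c) : exists y : mor t u, x = p1 ∘ α ∘ y.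
  have [x' x'E] := πs' (π x).
  have /αP[y yE] : π (p1 ∘ (i1 ∘ x + i2 ∘ x')) = π' (p2 ∘ (i1 ∘ x + i2 ∘ x')).
    rewrite !compmDr !compmA p11 p22 p12 p21 !comp1m !comp0m addr0 add0r.
    by rewrite x'E.
  exists y; rewrite -compmA -yE compmDr !compmA p11 p12.
  by rewrite comp1m comp0m addr0.
have surj2 (x' : mor t c') : exists y : mor t u, x' = p2 ∘ α ∘ y.
  have [x xE] := πs (π' x').
  have /αP[y yE] : π (p1 ∘ (i1 ∘ x + i2 ∘ x')) = π' (p2 ∘ (i1 ∘ x + i2 ∘ x')).
    rewrite !compmDr !compmA p11 p22 p12 p21 !comp1m !comp0m addr0 add0r.
    by rewrite xE.
  exists y; rewrite -compmA -yE compmDr !compmA p22 p21.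
  by rewrite comp1m comp0m add0r.
have [l1 [m1 [κ1 tr1]]] := triangle_cocone (p1 ∘ α).
have [l2 [m2 [κ2 tr2]]] := triangle_cocone (p2 ∘ α).
have [b1 [f1 [g1 tr1']]] := triangle_fibre (h ∘ (p1 ∘ α)).
have [b2 [f2 [g2 tr2']]] := triangle_fibre (h' ∘ (p2 ∘ α)).
rewrite (defect_precomp tr tr1 tr1' (surj_ghost tr1 surj1)).
rewrite (defect_precomp tr' tr2 tr2' (surj_ghost tr2 surj2)).
apply: (defect_kernel tr1' tr2') => y.
have /αP yE : exists w : mor t u, α ∘ y = α ∘ w by exists y.
by rewrite -!compmA -πk -πk' yE.
Qed.

(** Let [α] cover the kernel of $\operatorname{Hom}(t,c) \to M \to M''$. Then [κ] presents the
    quotient, $h\alpha$ presents the submodule, and [defect_comp] adds the two defects. *)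
Lemma defect_short_exact (M' M M'' : fgmod (endo t))
    (φ : {linear M' -> M}) (ψ : {linear M -> M''})
    a b c (f : mor a b) (g : mor b c) (h : mor c (Σ a)) :
  short_exact φ ψ -> triangle f g h -> presents M h ->
  exists a' b' c' (f' : mor a' b') (g' : mor b' c') (h' : mor c' (Σ a'))
    a'' b'' c'' (f'' : mor a'' b'') (g'' : mor b'' c'') (h'' : mor c'' (Σ a'')),
  [/\ triangle f' g' h', presents M' h', triangle f'' g'' h'', presents M'' h''
    & defect a b c = defect a' b' c' + defect a'' b'' c''].
Proof.
move=> [φI ψS exact_] tr [π [πs πk]].
pose ψπ : {linear hom_mod hf t c -> M''} := ψ \o π.
have [u [α [Tu αP]]] := linear_kernel_cover ψπ.
have [l [m [κ trα]]] := triangle_cocone α.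
have [b1 [f1 [g1 tr1]]] := triangle_fibre (h ∘ α).
have κP (x : mor t c) : ψ (π x) = 0 <-> κ ∘ x = 0.
  rewrite αP; split=> [[w ->]|]; first by rewrite compmA (triangle_comp23 trα) comp0m.
  exact: triangle_exact3 trα.
exists a, b1, u, f1, g1, (h ∘ α), l, u, c, m, α, κ; split=> //.
- pose p : {linear hom_mod hf t u -> M} := π \o hom_mod_map hf t α.
  have pE (y : mor t u) : p y = π (α ∘ y) by [].
  have [|q qE] := linear_lift (p := p) φI.
    move=> y; apply/exact_; rewrite pE.
    by have /αP : exists w : mor t u, α ∘ (y : mor t u) = α ∘ w by exists y.
  exists q; split=> [w|y].
    have [x xE] := πs (φ w).
    have /αP[y yE] : ψπ x = 0 by rewrite [LHS]/= xE; apply/exact_; exists w.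
    by exists y; apply: φI; rewrite qE pE -yE.
  rewrite -compmA -πk -[in X in _ <-> X]pE -qE; split=> [->|]; first exact: raddf0.
  by rewrite -(raddf0 φ) => /φI.
- exists ψπ; split=> // w; have [y <-] := ψS w; have [x <-] := πs y.
  by exists x.
apply: (defect_comp tr trα tr1) => x; rewrite -compmA -κP.
have -> : π (g ∘ x) = 0 by rewrite πk compmA (triangle_comp23 tr) comp0m.
exact: raddf0.
Qed.

(** The value on a generator is the defect of any triangle presenting it: [defect_presents] makes
    this well defined, [defect_short_exact] compatible with the relations. *)
Theorem error_term : exists θ : {additive K0mod (endo t) -> G},
  forall a b c (f : mor a b) (g : mor b c) (h : mor c (Σ a)) M,
    triangle f g h -> presents M h ->
    θ (K0mod_class M) = ind a - ind b + ind c.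
Proof.
have ex (M : fgmod (endo t)) : exists e, forall a b c (f : mor a b)
    (g : mor b c) (h : mor c (Σ a)), triangle f g h -> presents M h ->
    defect a b c = e.
  have [a [b [c [f [g [h [_ _ tr pr]]]]]]] := exists_presentation M.
  by exists (defect a b c) => *; apply: defect_presents; eauto.
have [e eP] := choice ex.
have [|θ θP] := @presented_liftB (fgmod (endo t)) (@K0mod_rel (endo t)) G e.
  move=> _ [M' [M [M'' [φ [ψ [se ->]]]]]]; exists M, M', M''; split=> //.
  have [a [b [c [f [g [h [_ _ tr pr]]]]]]] := exists_presentation M.
  have [a' [b' [c' [f' [g' [h' [a'' [b'' [c'' [f'' [g'' [h'' H]]]]]]]]]]]] :=
    defect_short_exact se tr pr.
  have [tr' pr' tr'' pr'' E] := H.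
  rewrite -(eP _ _ _ _ _ _ _ tr pr) -(eP _ _ _ _ _ _ _ tr' pr').
  by rewrite -(eP _ _ _ _ _ _ _ tr'' pr'').
by exists θ => a b c f g h M tr pr; rewrite θP -(eP _ _ _ _ _ _ _ tr pr).
Qed.

End ErrorTerm.

(** * Towers of triangles *)

Section Tower.
Variables (k : fieldType) (C : triangulated_category k).
Implicit Types a b c t x y z u v : C.
Local Notation Σ := (susp C).

(** Moving the sign to the first map leaves plain suspensions on the other two, the ones that enter
    exactness at the third term. *)
Lemma triangle_susp_sign13 a b c (f : mor a b) (g : mor b c) (h : mor c (Σ a)) :
  triangle f g h ->
  triangle (- fmap Σ f) (fmap Σ g) (fmap Σ h : mor (Σ c) (Σ (Σ a))).
Proof.
move=> /triangle_susp.
apply: (triangle_iso (is_iso_opp (is_iso_id _)) (is_iso_id _) (is_iso_id _)).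
- by rewrite comp1m compmNl compmNr compm1 opprK.
- by rewrite comp1m compm1.
by rewrite suspN fmap1 compmNl compmNr comp1m compm1 opprK.
Qed.

(* [H] is a power of the suspension: the induction passes from [H] to [H Σ]. *)
Lemma tower_connecting_inj t n (H : C -> C)
    (Hm : forall a b, mor a b -> mor (H a) (H b))
    (xs : nat -> C) y (xi : forall j, mor (xs j.+1) (xs j))
    (eps : mor (xs 0%N) y) (gam : mor y (suspn n.+1 (xs n.+1))) :
  (forall a b c (g : mor b c) (f : mor a b), Hm _ _ (g ∘ f) = Hm _ _ g ∘ Hm _ _ f) ->
  (forall a b c (f : mor a b) (g : mor b c) (h : mor c (Σ a)), triangle f g h ->
     forall u : mor t (H c), Hm _ _ h ∘ u = 0 ->
     exists w : mor t (H b), u = Hm _ _ g ∘ w) ->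
  triangle_tower xi eps gam ->
  (forall j i, (j <= n.+1)%N -> (i <= n)%N -> hom0 t (H (suspn i (xs j)))) ->
  forall u : mor t (H y), Hm _ _ gam ∘ u = 0 -> u = 0.
Proof.
elim: n H Hm xs y xi eps gam => [|n IH] H Hm xs y xi eps gam HM Hex /=.
  move=> tr V u /(Hex _ _ _ _ _ _ tr)[w ->].
  by rewrite (V 0%N 0%N _ _ w) // compm0.
move=> [v [f [e [g [gam' [tr _ tow ->]]]]]] V u; rewrite HM -compmA => gu.
suff /(Hex _ _ _ _ _ _ tr)[w ->] : Hm _ _ g ∘ u = 0.
  by rewrite (V 0%N 0%N _ _ w) // compm0.
apply: (IH (fun c => H (Σ c)) (fun a b f => Hm _ _ (fmap Σ f)) _ _ _ _ _ _ _
  tow _ _ gu).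
- by move=> *; rewrite fmapM HM.
- move=> a b c f1 g1 h1 tr1 u1; apply: Hex (triangle_susp_sign13 tr1) u1.
by move=> j i jn ni; apply: (V j.+1 i.+1).
Qed.

End Tower.

(** * The alternating sum of indices along a (d+2)-angle *)

Section Formula.
Variables (k : fieldType) (C : triangulated_category k).
Hypotheses (hf : hom_finite C) (spl : split_idempotents C).
Variables (m : nat) (S : C -> Prop) (t : C).
Hypotheses (S_ct : cluster_tilting m.+1 S) (S_stable : suspn_stable m.+1 S)
  (t_ct : OT_cluster_tilting m.+1 S t).
Implicit Types a b c x y z u v : C.
Local Notation Σ := (susp C).
Local Notation T := (add_closure t).
Local Notation ind := (tilting_index hf spl S_ct S_stable t_ct).

(** The composite connecting map [gam'] of the inner tower is ghost, so by induction [ind v] is the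
    alternating sum of the inner terms and only the defect of the first triangle survives. *)
Lemma tower_index n (xs : nat -> C) y (xi : forall j, mor (xs j.+1) (xs j))
    (eps : mor (xs 0%N) y) (gam : mor y (suspn n.+1 (xs n.+1))) :
  triangle_tower xi eps gam -> (forall j, (j <= n.+1)%N -> S (xs j)) ->
  (n <= m)%N ->
  exists a b (f : mor a b) (g : mor b y) (h : mor y (Σ a)),
  [/\ triangle f g h,
      forall u : mor t y, h ∘ u = 0 <-> gam ∘ u = 0
    & ind y - \sum_(j < n.+2) ind (xs j) *~ (-1) ^+ j =
      ind a - ind b + ind y].
Proof.
have [St _ _] := t_ct.
elim: n xs y xi eps gam => [|n IH] xs y xi eps gam.
  move=> /= tr Sxs _; exists (xs 1%N), (xs 0%N), (xi 0%N), eps, gam; split=> //.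
  by rewrite (big_alt_recl _ (fun j => ind (xs j))) big_ord1 opprB addrC.
move=> /= [v [f [e [g [gam' [tr _ tow ->]]]]]] Sxs nm.
have Sxs' j : (j <= n.+1)%N -> S (xs j.+1) by move=> jn; apply: (Sxs j.+1).
have [|a' [b' [f' [g' [h' [tr' hg' E]]]]]] := IH _ _ _ _ _ tow Sxs'; first by lia.
have gam'0 : ghost t gam'.
  move=> w; apply: (tilting_hom0 S_ct St _ (i := n.+1)); [exact: (Sxs n.+2)|lia].
have E' : ind v = \sum_(j < n.+2) ind (xs j.+1) *~ (-1) ^+ j.
  apply/eqP; rewrite -subr_eq0 E; apply/eqP.
  have h'0 : ghost t h' by move=> w; apply/hg'/gam'0.
  by apply: defect_ghost tr' h'0; apply: tilting_index_additive.
exists v, (xs 0%N), f, eps, g; split=> //; last first.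
  by rewrite (big_alt_recl _ (fun j => ind (xs j))) -E' opprB addrC.
move=> u; split=> [gu|]; first by rewrite -compmA gu compm0.
rewrite -compmA => gu.
(* Composition with the suspension of [gam'] is injective on maps from [t], as only degrees between
   1 and [m] occur; hence [g] and [gam] have the same kernel. *)
apply: (tower_connecting_inj _ _ tow _ gu) => [*|a b c f1 g1 h1 tr1 u1|j i jn ni].
- exact: fmapM.
- by move=> /(triangle_exact3 (triangle_susp_sign13 tr1)).
by apply: (tilting_hom0 S_ct St _ (i := i.+1)); [apply: Sxs'|lia].
Qed.

Lemma angulated_error_term :
  exists θ : {additive K0mod (endo t) -> K0sp T},
  forall (s : nat -> C) (sigma : forall i, mor (s i.+1) (s i))
         (gam : mor (s 0%N) (suspn m.+1 (s m.+2))),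
    angle S (fun i => sigma i.+1) (sigma 0%N) gam ->
    \sum_(i < m.+3) ind (s i) *~ (-1) ^+ i =
    θ (K0mod_class (image_mod (hom_mod_map hf t gam))).
Proof.
have [θ θP] := error_term hf (tilting_index_additive hf spl S_ct S_stable t_ct).
exists θ => s sigma gam [Ss0 Ss tow].
have [a [b [f [g [h [tr hg E]]]]]] := tower_index tow Ss (leqnn _).
rewrite (big_alt_recl _ (fun j => ind (s j))) E; apply/esym/(θP _ _ _ _ _ _ _ tr).
(* The corestriction of $\operatorname{Hom}(t,\gamma)$ to its image shows that [h] presents this
   image, the kernels being equal by [hg]. *)
pose N := image_mod (hom_mod_map hf t gam).
pose π (x : hom_mod hf t (s 0%N)) : N :=
  exist _ (hom_mod_map hf t gam x) (asboolT (ex_intro _ x erefl)).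
have πl : linear π.
  by move=> r x y; apply: val_inj; rewrite [LHS]linearP.
pose P := GRing.isLinear.Build _ _ _ _ π πl.
pose π' : {linear hom_mod hf t (s 0%N) -> N} := HB.pack π P.
exists π'; split=> [[w wP]|x].
  by have /asboolP[x xE] := wP; exists x; apply: val_inj.
rewrite hg; split=> [/(congr1 val) //|gx]; exact: val_inj.
Qed.

End Formula.

(** * Existence of radical angles *)

(** Iterating the relation gives $h^m = h^{m+j} r^j$, so $e = h^m r^m$ is the Fitting idempotent;
    when $e = 1$ the inverse of $h$ is $h^m r^{m+1}$. *)
Lemma pi_regular_idempotent (R : pzRingType) (h r : R) m :
  h * r = r * h -> h ^+ m = h ^+ m.+1 * r ->
  exists e : R, [/\ e * e = e, h ^+ m * e = h ^+ m
    & e = 1 -> exists g, g * h = 1 /\ h * g = 1].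
Proof.
move=> hr E; have cr i j : GRing.comm (h ^+ i) (r ^+ j) by apply/commrX/commr_sym/commrX.
have Ej j : h ^+ m = h ^+ (m + j) * r ^+ j.
  elim: j => [|j IH]; first by rewrite addn0 mulr1.
  rewrite addnS -addSn addnC exprD (exprS r) mulrA -(mulrA (h ^+ j)) -E.
  by rewrite -exprD addnC.
exists (h ^+ m * r ^+ m); split.
- by rewrite mulrA -(mulrA (h ^+ m)) -cr mulrA -exprD -Ej.
- by rewrite mulrA -exprD -Ej.
move=> e1; exists (h ^+ m * r ^+ m.+1).
have hg : h * (h ^+ m * r ^+ m.+1) = 1.
  by rewrite mulrA -exprS (exprS r) mulrA -E.
split=> //; rewrite -[RHS]hg mulrA -exprS.
by rewrite -mulrA -[X in _ * X](cr 1%N m.+1) expr1 mulrA -exprSr.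
Qed.

Section Fitting.
Variables (k : fieldType) (C : klinear_category k).
Implicit Types a b c x y : C.

(** A linear relation among $1, h, \dots, h^n$, divided by its lowest nonzero coefficient, expresses
    some $h^i$ as $h^{i+1} r$ with $r$ a polynomial in $h$. *)
Lemma endo_pi_regular x n (h : mor x x) : Vector.axiom n (mor x x) ->
  exists m (r : endo x), (h : endo x) * r = r * h /\
    (h : endo x) ^+ m = (h : endo x) ^+ m.+1 * r.
Proof.
move=> [v2r v2r_lin [r2v v2rK r2vK]]; pose p i : mor x x := (h : endo x) ^+ i.
pose A := \matrix_(i < n.+1) v2r (p i).
have : (0 < \rank (kermx A))%N.
  by rewrite mxrank_ker subn_gt0 ltnS rank_leq_col.
rewrite lt0n mxrank_eq0 => /rowV0Pn[c /sub_kermxP cA c0].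
have v2r0 : v2r 0 = 0.
  by have := v2r_lin (-1) 0 0; rewrite scaler0 addr0 scaleN1r addNr.
have v2rD : {morph v2r : u v / u + v}.
  by move=> u v; have := v2r_lin 1 u v; rewrite !scale1r.
have v2rZ s u : v2r (s *: u) = s *: v2r u.
  by have := v2r_lin s u 0; rewrite v2r0 !addr0.
have rel : \sum_i c 0 i *: p i = 0.
  apply: (can_inj v2rK); rewrite v2r0 (big_morph _ v2rD v2r0) -[RHS]cA mulmx_sum_row.
  by apply: eq_bigr => i _; rewrite v2rZ rowK.
have /rV0Pn[i0 ci0] := c0.
case: (arg_minnP (fun i : 'I_n.+1 => i : nat) (P := fun i => c 0 i != 0) ci0).
move=> i ci imin; exists i.
pose r : mor x x :=
  - (c 0 i)^-1 *: \sum_(j < n.+1 | (i < j)%N) c 0 j *: p (j - i.+1)%N.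
exists r; split.
  rewrite -[LHS]/(h ∘ r) -[RHS]/(r ∘ h) /r compmZr compmZl; congr (_ *: _).
  rewrite compm_sumr compm_suml; apply: eq_bigr => j _.
  rewrite compmZr compmZl; congr (_ *: _).
  by rewrite -[LHS]/((h : endo x) * (h : endo x) ^+ _) -exprS exprSr.
rewrite -[RHS]/(p i.+1 ∘ r) /r compmZr compm_sumr -[LHS]/(p i).
have -> : \sum_(j < n.+1 | (i < j)%N) p i.+1 ∘ (c 0 j *: p (j - i.+1)%N) =
    \sum_(j < n.+1 | (i < j)%N) c 0 j *: p j.
  apply: eq_bigr => j ij; rewrite compmZr; congr (_ *: _).
  rewrite -[LHS]/((h : endo x) ^+ i.+1 * (h : endo x) ^+ (j - i.+1)).
  by rewrite -exprD subnKC.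
have : c 0 i *: p i + \sum_(j < n.+1 | (i < j)%N) c 0 j *: p j = 0.
  rewrite -[RHS]rel [RHS](bigD1 i) //=; congr (_ + _).
  rewrite big_mkcond [RHS]big_mkcond; apply: eq_bigr => j _.
  have [ij|ji|/val_inj->] := ltngtP i j; last by rewrite eqxx.
    by have -> : j != i by apply: contraTneq ij => ->; rewrite ltnn.
  have [/eqP->|/imin] := boolP (c 0 j == 0); last by rewrite leqNgt ji.
  by rewrite scale0r if_same.
move/eqP; rewrite addrC addr_eq0 => /eqP ->.
by rewrite scaleNr scalerN opprK scalerA mulVf // scale1r.
Qed.

Hypothesis hf : hom_finite C.
Hypothesis spl : split_idempotents C.

Lemma fitting x (h : mor x x) : exists n b (p : mor x b) (i : mor b x),
  [/\ p ∘ i = idm b, ((h : endo x) ^+ n : mor x x) ∘ (i ∘ p) = (h : endo x) ^+ n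
    & i ∘ p = idm x -> is_iso h].
Proof.
have [n [V]] := hf x x; have [m [r [hr E]]] := endo_pi_regular h V.
have [e [ee he e1]] := pi_regular_idempotent hr E.
have [b [p [i [ipe pi]]]] := spl ee.
by exists m, b, p, i; split=> //; rewrite ipe.
Qed.

End Fitting.

Lemma injective_linear_leq (k : fieldType) (U V : lmodType k) n n'
    (φ : U -> V) :
  Vector.axiom n U -> Vector.axiom n' V -> linear φ -> injective φ ->
  (n <= n')%N /\ (n = n' -> forall v, exists u, φ u = v).
Proof.
move=> [uf ul [ug ufK ugK]] [vf vl [vg vfK vgK]] φl φI.
have ugl : linear ug.
  by move=> r x y; apply: (can_inj ufK); rewrite ugK ul !ugK.
pose ψ x := vf (φ (ug x)).
have ψl : linear ψ by move=> r x y; rewrite /ψ ugl φl vl.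
pose Q := GRing.isLinear.Build _ _ _ _ ψ ψl.
pose ψ' : {linear 'rV[k]_n -> 'rV[k]_n'} := HB.pack ψ Q.
pose A := lin1_mx ψ'; have AE x : x *m A = ψ x by rewrite mul_rV_lin1.
have free : row_free A.
  rewrite -kermx_eq0; apply/eqP/row_matrixP => i; rewrite row0.
  have : row i (kermx A) *m A = 0.
    by rewrite -row_mul mulmx_ker row0.
  rewrite AE -(raddf0 ψ') => /(can_inj vfK)/φI/(can_inj ugK).
  by [].
have le : (n <= n')%N by rewrite -(eqP free) rank_leq_col.
split=> // nn' v; subst n'.
have /submxP[x xE] : (vf v <= A)%MS by apply: submx_full; exact: free.
by exists (ug x); apply: (can_inj vfK); rewrite xE AE.
Qed.

(** * Radical precovers, and agreement of the two indices on S *)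

Section Minimal.
Variables (k : fieldType) (C : triangulated_category k).
Hypotheses (hf : hom_finite C) (spl : split_idempotents C).
Variable t : C.
Implicit Types a b c x y z u v : C.
Local Notation Σ := (susp C).
Local Notation T := (add_closure t).
Let C_additive := tri_additive C.

Lemma endo_pow_fix x c (g : mor x c) (h : mor x x) n :
  g ∘ h = g -> g ∘ ((h : endo x) ^+ n : mor x x) = g.
Proof.
move=> gh; elim: n => [|n IH]; first exact: compm1.
have -> : ((h : endo x) ^+ n.+1 : mor x x) = h ∘ ((h : endo x) ^+ n : mor x x).
  exact: (exprS (h : endo x) n).
by rewrite compmA gh IH.
Qed.

(* Take a precover with Hom(t, x) of minimal dimension: an endomorphism of x over
   c splits off, by Fitting's lemma, a smaller precover unless it is invertible. *)
Lemma exists_radical_precover c : exists c' x (f : mor c' x) (g : mor x c)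
  (h : mor c (Σ c')), [/\ T x, triangle f g h, ghost t h & radical f].
Proof.
pose P n := `[< exists x (g : mor x c), [/\ T x, inhabited (Vector.axiom n (mor t x))
  & forall w : mor t c, exists y : mor t x, w = g ∘ y] >].
have exP : exists n, P n.
  have [c' [x [f [g [h [Tx tr h0]]]]]] := exists_precover hf t c.
  have [n V] := hf t x; exists n; apply/asboolP; exists x, g; split=> // w.
  exact: ghost_lift tr h0.
case: (ex_minnP exP) => n /asboolP[x [g [Tx [V] gs]]] nmin.
have [c' [f [h tr]]] := triangle_cocone g.
exists c', x, f, g, h; split=> //; first exact: surj_ghost tr gs.
move=> r; apply: is_iso_id_sub_swap; set e := idm x - f ∘ r.
have ge : g ∘ e = g by rewrite compmBr compm1 compmA (triangle_comp12 tr) comp0m subr0.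
have [l [b [p [i [pi eip e_iso]]]]] := fitting hf spl e; apply: e_iso.
have gip : g ∘ (i ∘ p) = g by rewrite -{1}(endo_pow_fix l ge) -compmA eip endo_pow_fix.
have [n' [V']] := hf t b.
have il : linear (fun w : mor t b => i ∘ w) by apply: compm_linear_r.
have iI : injective (fun w : mor t b => i ∘ w).
  by move=> w w' /(congr1 (fun w => p ∘ w)); rewrite !compmA pi !comp1m.
have [nn' surj] := injective_linear_leq V' V il iI.
have /surj{}surj : n' = n.
  apply/eqP; rewrite eqn_leq nn' nmin //; apply/asboolP.
  exists b, (g ∘ i); split; [exact: add_closure_retract pi Tx | by [] |].
  move=> w; have [y ->] := gs w; exists (p ∘ y).
  by rewrite compmA -(compmA g) gip.
apply/eqP; rewrite -subr_eq0; apply/eqP; apply: (add_closure_eq0 Tx) => w.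
have [w' <-] := surj w.
by rewrite compmBl comp1m -compmA (compmA p) pi comp1m subrr.
Qed.

(** Radical precovers are iterated, and comparison with the given resolution puts the last syzygy in
    [T]. Each map of the tower is radical because its factor [f] is. *)
Lemma resolution_radical_tower n y (ζ : K0sp T) : resolution n.+1 y ζ ->
  exists (x : nat -> full_sub T)
         (xi : forall j, mor (sval (x j.+1)) (sval (x j)))
         (eps : mor (sval (x 0%N)) y)
         (gam : mor y (suspn n.+1 (sval (x n.+1)))),
    triangle_tower (x := fun j => sval (x j)) xi eps gam /\
    forall j, (j < n.+1)%N -> radical (xi j).
Proof.
elim: n y ζ => [|n IH] y ζ r;
  have [y' [x0 [f [g [h [Tx tr h0 rf]]]]]] := exists_radical_precover y;
  have r' := resolution_syzygy hf spl r Tx tr h0.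
  have [Ty' _] := r'.
  pose x j : full_sub T := if j is _.+1 then exist T y' Ty' else exist T x0 Tx.
  pose xi j : mor (sval (x j.+1)) (sval (x j)) :=
    match j with 0 => f | j'.+1 => 0 : mor y' y' end.
  by exists x, xi, g, h; split=> // -[].
have [x' [xi' [eps' [gam' [tow rad]]]]] := IH _ _ r'.
pose x j : full_sub T := if j is j'.+1 then x' j' else exist T x0 Tx.
pose xi j : mor (sval (x j.+1)) (sval (x j)) :=
  match j with 0 => f ∘ eps' | j'.+1 => xi' j' end.
exists x, xi, g, (fmap Σ gam' ∘ h); split; first by exists y', f, eps', h, gam'.
by move=> [|j] jn; [apply: radical_comp | apply: rad].
Qed.

Variables (m : nat) (S : C -> Prop).
Hypotheses (S_ct : cluster_tilting m.+1 S) (S_stable : suspn_stable m.+1 S)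
  (t_ct : OT_cluster_tilting m.+1 S t).

(** The angle is a resolution of length $d \leqslant N$, and all resolutions of length at most [N]
    have the same alternating sum. *)
Lemma is_index_tilting_index s (ζ : K0sp T) : is_index S m.+1 s ζ ->
  ζ = tilting_index hf spl S_ct S_stable t_ct s.
Proof.
move=> [x [xi [eps [gam [[Ss Sx tow] _ ->]]]]]; apply/esym.
have -> : \sum_(j < m.+2) K0sp_class (x j) *~ (-1) ^+ j =
    \sum_(j < m.+2) addK0 t (sval (x j)) *~ (-1) ^+ j.
  by apply: eq_bigr => j _; rewrite addK0E.
have r := tower_resolution S_ct S_stable t_ct tow
  (fun j _ => svalP (x j)) (leqnn _).
by apply: (tilting_index_resolution _ _ _ _ _ _ r); lia.
Qed.

(** Radical towers exist over every object of [S], so the default value 0 is not taken there. *)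
Lemma angulated_indexE s : S s ->
  angulated_index S m.+1 t s = tilting_index hf spl S_ct S_stable t_ct s.
Proof.
move=> Ss; rewrite /angulated_index; case: pselect => [e|[]].
  by case: (cid e) => z /= /is_index_tilting_index.
have [ζ r] := OT_resolution S_ct S_stable t_ct Ss.
have [x [xi [eps [gam [tow rad]]]]] := resolution_radical_tower r.
eexists; exists x, xi, eps, gam; split=> //; split=> // j _.
exact: (add_closure_tilting S_ct t_ct (svalP (x j))).
Qed.

End Minimal.

(** * Uniqueness *)

(** Unique existence compares additive maps as records, so pointwise equality is upgraded by
    extensionality and proof irrelevance. *)
Lemma additive_eq (U V : zmodType) (f g : {additive U -> V}) : f =1 g -> f = g.
Proof.
case: f g => f [[fP]] [g [[gP]]] /= /funext E; subst g.
by rewrite (Prop_irrelevance fP gP).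
Qed.

Section K0.
Variables (Gam : pzRingType).
Implicit Types M N Z : fgmod Gam.

Lemma K0mod_short_exact M' M M'' (f : {linear M' -> M}) (g : {linear M -> M''}) :
  short_exact f g -> K0mod_class M = K0mod_class M' + K0mod_class M''.
Proof.
by move=> se; apply: presented_relB; exists M', M, M'', f, g.
Qed.

(** For such [M] the identities $M \to M \to M$ form a short exact sequence. *)
Lemma K0mod_zero M : (forall x : M, x = 0) -> K0mod_class M = 0.
Proof.
move=> M0; apply: (addrI (K0mod_class M)).
rewrite addr0 -[LHS](@K0mod_short_exact M M M idfun idfun) //.
split=> // [w|y]; first by exists w.
by split=> _; [exists y | apply: M0].
Qed.

(** An isomorphism is a short exact sequence with zero quotient [Z]; this module is a parameter,
    supplied later as Hom into a zero object. *)
Lemma K0mod_iso M N (Z : fgmod Gam) (f : {linear M -> N}) : (forall x : Z, x = 0) ->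
  injective f -> (forall y, exists x, f x = y) -> K0mod_class N = K0mod_class M.
Proof.
move=> Z0 fI fS; pose o (_ : N) : Z := 0.
have ol : linear o by move=> r x y; rewrite [RHS]Z0.
pose Q := GRing.isLinear.Build _ _ _ _ o ol.
pose o' : {linear N -> Z} := HB.pack o Q.
rewrite (@K0mod_short_exact M N Z f o') ?(K0mod_zero Z0) ?addr0 //.
by split=> // z; exists 0; rewrite [z in RHS]Z0.
Qed.

Definition image_incl M N (f : {linear M -> N}) (y : image_mod f) : N := val y.

Fact image_incl_linear M N (f : {linear M -> N}) : linear (@image_incl M N f).
Proof. by move=> r x y. Qed.

HB.instance Definition _ M N (f : {linear M -> N}) :=
  GRing.isLinear.Build _ _ _ _ (@image_incl M N f) (@image_incl_linear M N f).

Lemma image_incl_inj M N (f : {linear M -> N}) : injective (@image_incl M N f).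
Proof. exact: val_inj. Qed.

Lemma image_inclP M N (f : {linear M -> N}) (y : image_mod f) :
  exists x, image_incl y = f x.
Proof. by case: y => y yP; have /asboolP[x xy] := yP; exists x. Qed.

Lemma image_incl_image M N (f : {linear M -> N}) (x : M) :
  exists y : image_mod f, image_incl y = f x.
Proof. by exists (exist _ (f x) (asboolT (ex_intro _ x erefl))). Qed.

End K0.

(** * Completing a morphism to a (d+2)-angle *)

Section Completion.
Variables (k : fieldType) (C : triangulated_category k).
Hypothesis hf : hom_finite C.
Variables (m : nat) (S : C -> Prop) (t : C).
Hypotheses (S_ct : cluster_tilting m.+1 S) (S_stable : suspn_stable m.+1 S).
Implicit Types a b c u v x y : C.
Local Notation Σ := (susp C).

Lemma image_comp_iso x y y' (φ : mor x y) (w : mor y y') : is_iso w ->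
  K0mod_class (image_mod (hom_mod_map hf t (w ∘ φ))) =
  K0mod_class (image_mod (hom_mod_map hf t φ)).
Proof.
case=> w' [w'w ww'].
pose p : {linear image_mod (hom_mod_map hf t φ) -> hom_mod hf t y'} :=
  hom_mod_map hf t w \o @image_incl _ _ _ (hom_mod_map hf t φ).
have pE z : p z = w ∘ (image_incl z : mor t y) by [].
have [z|q qE] :=
  linear_lift (p := p) (@image_incl_inj _ _ _ (hom_mod_map hf t (w ∘ φ))).
  have [r rE] := image_inclP z.
  have [z' z'E] := image_incl_image (hom_mod_map hf t (w ∘ φ)) r.
  exists z'; rewrite [LHS]z'E pE [RHS](congr1 (fun g : mor t y => w ∘ g) rE).
  exact/esym/compmA.
have [z0 z00] := (tri_additive C).1.
apply: (K0mod_iso (Z := hom_mod hf t z0) (f := q)).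
- by move=> r; apply: (zero_object_cod (r : mor t z0) z00).
- move=> r r' E; apply: image_incl_inj.
  have : p r = p r' by rewrite -!qE E.
  rewrite !pE => /(congr1 (fun g : mor t y' => w' ∘ g)).
  by rewrite !compmA w'w !comp1m.
move=> z; have [r rE] := image_inclP z.
have [z' z'E] := image_incl_image (hom_mod_map hf t φ) r.
exists z'; apply: image_incl_inj; rewrite qE pE rE.
rewrite [LHS](congr1 (fun g : mor t y => w ∘ g) z'E).
exact: compmA.
Qed.

(* The terms are right S-approximations of iterated syzygies of the fibre of
   [gam]; each step enlarges the range of vanishing of Hom(S, Σ^j -) by one,
   until the syzygy itself is in S. *)
Lemma complete_tower n v s (gam : mor v (suspn n.+1 s)) b (β : mor b v)
    (δ : mor (suspn n.+1 s) (Σ b)) :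
  triangle β gam δ -> S s -> (n <= m)%N ->
  (forall s' j, S s' -> (0 < j <= m - n)%N -> hom0 s' (suspn j b)) ->
  exists (x : nat -> C) (xi : forall j, mor (x j.+1) (x j)) (eps : mor (x 0%N) v)
    (gam0 : mor v (suspn n.+1 (x n.+1)))
    (w : mor (suspn n.+1 s) (suspn n.+1 (x n.+1))),
  [/\ triangle_tower xi eps gam0, forall j, (j <= n.+1)%N -> S (x j), is_iso w
    & gam0 = w ∘ gam].
Proof.
elim: n v gam b β δ => [|n IH] v gam b β δ tr Ss nm bV;
  have [i tri] := triangle_rotr tr.
  have Sb : S b by apply: (tiltingP S_ct) => s' j Ss' jm; apply: bV => //; lia.
  pose x j := if j is _.+1 then s else b.
  pose xi j : mor (x j.+1) (x j) :=
    match j with 0 => i | j'.+1 => 0 : mor s s end.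
  exists x, xi, β, gam, (idm _); split; rewrite ?comp1m //; last exact: is_iso_id.
  by case.
have [fin _ _] := S_ct.
have [[x0 [f [Sx0 fP]]] _] := fin b.
have [l [f' [κ trf]]] := triangle_cocone f.
have [v' [j [ε trj]]] := triangle_cocone (β ∘ f).
have [p [gam' [tr' _ _ E]]] := octahedron_cocone trf tri trj.
have lV s' r : S s' -> (0 < r <= m - n)%N -> hom0 s' (suspn r l).
  case: r => [//|[|r]] Ss' rm.
    move=> q; have [|q' ->] := triangle_exact1 (u := q) trf.
      by apply: (tilting_hom0 S_ct Ss' Sx0 (i := 1%N)); lia.
    by have [q'' ->] := fP _ q' Ss'; rewrite compmA (triangle_comp23 trf) comp0m.
  apply: hom0_triangle_suspnS trf _ _; first by apply: bV => //; lia.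
  by apply: (tilting_hom0 S_ct) => //; lia.
have [x' [xi' [eps' [gam0 [w [tow Sx' wi gam0E]]]]]] :=
  IH _ _ _ _ _ tr' Ss (ltnW nm) lV.
pose x r := if r is r'.+1 then x' r' else x0.
pose xi r : mor (x r.+1) (x r) :=
  match r with 0 => j ∘ eps' | r'.+1 => xi' r' end.
exists x, xi, (β ∘ f), (fmap Σ gam0 ∘ ε), (fmap Σ w); split.
- by exists v', j, eps', ε, gam0.
- by case=> [|r] rn //; apply: Sx'.
- exact: susp_is_iso.
by rewrite gam0E fmapM -compmA E.
Qed.

End Completion.

Section Uniqueness.
Variables (k : fieldType) (C : triangulated_category k).
Hypothesis hf : hom_finite C.
Variables (m : nat) (S : C -> Prop) (t : C).
Hypotheses (S_ct : cluster_tilting m.+1 S) (S_stable : suspn_stable m.+1 S)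
  (t_ct : OT_cluster_tilting m.+1 S t).
Implicit Types a b c u v x y : C.
Local Notation Σ := (susp C).

(** By stability, [b] is isomorphic to some $\Sigma^d s'$ with $s'$ in [S]; changing the target of
    [φ] by isomorphisms preserves the class of the image. *)
Lemma exists_angle_image a b (φ : mor a b) : S a -> S b ->
  exists (s : nat -> C) (sigma : forall i, mor (s i.+1) (s i))
         (gam : mor (s 0%N) (suspn m.+1 (s m.+2))),
    angle S (fun i => sigma i.+1) (sigma 0%N) gam /\
    K0mod_class (image_mod (hom_mod_map hf t gam)) =
    K0mod_class (image_mod (hom_mod_map hf t φ)).
Proof.
move=> Sa /S_stable[s' [Ss' [e [e' [e'e ee']]]]].
have e'i : is_iso e' by exists e.
have [b' [β [δ' tr']]] := triangle_cocone (e' ∘ φ).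
have [|x [xi [eps [gam [w [tow Sx wi gamE]]]]]] :=
  complete_tower S_ct tr' Ss' (leqnn m).
  (* For $n = m$ the range of required vanishing is empty. *)
  by move=> s'' j _; rewrite subnn; case: j.
pose s r := if r is r'.+1 then x r' else a.
pose sigma r : mor (s r.+1) (s r) :=
  match r with 0 => eps | r'.+1 => xi r' end.
exists s, sigma, gam; split; first by [].
by rewrite gamE !image_comp_iso.
Qed.

(** A presentation makes [M] the cokernel of $\operatorname{Hom}(t,g)$; writing
    $\operatorname{Hom}(t,c)$ as the image of an identity puts both classes in the form realised by
    angles. *)
Lemma K0mod_class_image (M : fgmod (endo t)) : exists b c (φ : mor b c),
  [/\ S b, S c & K0mod_class M =
    K0mod_class (image_mod (hom_mod_map hf t (idm c))) -
    K0mod_class (image_mod (hom_mod_map hf t φ))].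
Proof.
have [a [b [c [f [g [h [Tb Tc tr [π [πs πk]]]]]]]]] := exists_presentation hf M.
exists b, c, g; split.
- exact: (add_closure_tilting S_ct t_ct Tb).
- exact: (add_closure_tilting S_ct t_ct Tc).
have [z0 z00] := (tri_additive C).1.
rewrite -(@K0mod_iso _ _ _ (hom_mod hf t z0) (@image_incl _ _ _ (hom_mod_map hf t (idm c)))).
- have := @K0mod_short_exact _ (image_mod (hom_mod_map hf t g)) _ M
    (@image_incl _ _ _ (hom_mod_map hf t g)) π.
  move=> -> //; first by rewrite addrC addKr.
  split; [exact: image_incl_inj|by []|move=> y].
  rewrite πk; split=> [|[z <-]].
    move=> /(triangle_exact3 tr)[w wE].
    have [z zE] := image_incl_image (hom_mod_map hf t g) w.
    by exists z; rewrite [LHS]zE; apply/esym.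
  have [w wE] := image_inclP z.
  rewrite [LHS](congr1 (fun r : mor t c => h ∘ r) wE) [LHS]compmA.
  by rewrite (triangle_comp23 tr) comp0m.
- by move=> r; apply: (zero_object_cod (r : mor t z0) z00).
- exact: image_incl_inj.
move=> y; have [z zE] := image_incl_image (hom_mod_map hf t (idm c)) y.
by exists z; rewrite [LHS]zE; apply: comp1m.
Qed.

End Uniqueness.

(** * Existence from the error term, uniqueness from its values on images *)

Theorem theoremC (k : fieldType) (d : nat) (C : triangulated_category k)
    (S : C -> Prop) (t : C)
    (d_gt0 : (1 <= d)%N)
    (C_hom_finite : hom_finite C)
    (C_split : split_idempotents C)
    (S_cluster_tilting : cluster_tilting d S)
    (S_stable : suspn_stable d S)
    (t_cluster_tilting : OT_cluster_tilting d S t) :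
  exists! theta : {additive K0mod (endo t) -> K0sp (add_closure t)},
    forall (s : nat -> C) (sigma : forall i, mor (s i.+1) (s i))
           (gam : mor (s 0%N) (suspn d (s d.+1))),
      angle S (fun i => sigma i.+1) (sigma 0%N) gam ->
      \sum_(i < d.+2) angulated_index S d t (s i) *~ (-1) ^+ i =
      theta (K0mod_class (image_mod (hom_mod_map C_hom_finite t gam))).
Proof.
case: d d_gt0 S_cluster_tilting S_stable t_cluster_tilting => // m _ Sct Sst tct.
have [θ θP] := angulated_error_term C_hom_finite C_split Sct Sst tct.
(* The terms of an angle lie in [S], where the angulated index is [tilting_index]. *)
have indexE (s : nat -> C) (sigma : forall i, mor (s i.+1) (s i))
    (gam : mor (s 0%N) (suspn m.+1 (s m.+2))) :
  angle S (fun i => sigma i.+1) (sigma 0%N) gam ->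
  \sum_(i < m.+3) angulated_index S m.+1 t (s i) *~ (-1) ^+ i =
  θ (K0mod_class (image_mod (hom_mod_map C_hom_finite t gam))).
  move=> ang; rewrite -(θP _ _ _ ang); apply: eq_bigr => i _; congr (_ *~ _).
  apply: angulated_indexE; case: ang => [S0 Ss _].
  by case: i => [[|i]] im //; apply: Ss.
(* Module classes generate the Grothendieck group, and each is a difference of classes of images of
   maps in [S]. *)
exists θ; split=> // θ' θ'P; apply: additive_eq; apply: presented_ext => M.
have [b [c [φ [Sb Sc E]]]] := K0mod_class_image C_hom_finite Sct tct M.
have {}E : presented_gen (K0mod_rel (Gam:=endo t)) M =
  K0mod_class (image_mod (hom_mod_map C_hom_finite t (idm c))) -
  K0mod_class (image_mod (hom_mod_map C_hom_finite t φ)) := E.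
(* The class of such an image is also that of the last map of some angle, where the formula
   determines both homomorphisms. *)
have agree a b' (f : mor a b') : S a -> S b' ->
    θ (K0mod_class (image_mod (hom_mod_map C_hom_finite t f))) =
    θ' (K0mod_class (image_mod (hom_mod_map C_hom_finite t f))).
  move=> Sa Sb'.
  have [s [sigma [gam [ang <-]]]] := exists_angle_image C_hom_finite t Sct Sst f Sa Sb'.
  by rewrite -(indexE _ _ _ ang) -(θ'P _ _ _ ang).
by rewrite E !raddfB !agree.
Qed.
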